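(* Let $k$ be a commutative ring, let $\mathcal{D}$ be a small category, and let $\mu$ be a homological modulus for $\mathcal{D}$ over $k$, where the sets $\mu(d)$ are not required to be finite. Let $V$ be a representation of $\mathcal{D}$ over $k$ generated in degrees $\{d_i\}_{i\in I}$, for a (possibly infinite) family of objects. For an integer $q\geq 0$ let $\mathcal{E}_q$ be the full subcategory of $\mathcal{D}$ spanned by the objects $$\bigcup_{p=0}^{q+1}\mu^p(\{d_i\}_{i\in I}).$$ Then for any representation $W$ of $\mathcal{D}$ over $k$ we have $$\operatorname{Ext}^q_{\mathcal{D}}(V,W)\simeq \operatorname{Ext}^q_{\mathcal{E}_q}(V',W'),$$ where $V'$ and $W'$ are the restrictions of $V$ and $W$ to $\mathcal{E}_q$. If $k$ is Noetherian, $V$ is finitely generated, $W'$ takes values in finitely generated $k$-modules, and the hom-sets $\operatorname{Hom}_{\mathcal{E}_q}(x,y)$ are finite, then $\operatorname{Ext}^q_{\mathcal{D}}(V,W)$ is finitely generated as a $k$-module.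
   Context: A representation of a small category $\mathcal{D}$ over $k$ is a functor $V:\mathcal{D}\to\mathrm{Mod}_k$ to the category of $k$-modules; maps are natural transformations, and kernels and images are formed objectwise, so the category $\mathrm{Rep}_k(\mathcal{D})$ of representations is abelian. $\operatorname{Ext}^q_{\mathcal{D}}$ and $\operatorname{Ext}^q_{\mathcal{E}_q}$ denote Ext in $\mathrm{Rep}_k(\mathcal{D})$ and $\mathrm{Rep}_k(\mathcal{E}_q)$. $V$ is generated in degrees $\{d_i\}_{i\in I}$ if any subrepresentation $U\subseteq V$ with $U(d_i)=V(d_i)$ for all $i\in I$ equals $V$. $V$ is finitely generated if it is generated in degrees $\{e_1,\dots,e_l\}$ for some finite list of objects $e_j\in\mathcal{D}$ and each $V(e_j)$ is finitely generated as a $k$-module. (Concretely, if $V$ is finitely generated, then there are finitely many $v_j\in V(e_j)$ spanning $V$ using scalars from $k$ and arrows from $\mathcal{D}$.) For objects $x,y\in\mathcal{D}$, let $S(x,y)$ be the set of morphisms $x\to x$ that factor through $y$. For $d\in\mathcal{D}$ and $s\in S(x,y)$, let $M_s$ be the square $0$-$1$ matrix with rows and columns indexed by $\operatorname{Hom}_{\mathcal{D}}(d,x)$, whose $(f,g)$ entry is $1$ if $s\circ f=g$ and $0$ otherwise. Write $x\leq_d y$ if the identity matrix lies in the $k$-span of the matrices $M_s$, $s\in S(x,y)$. In this statement a homological modulus for $\mathcal{D}$ over $k$ is a function $\mu$ from objects of $\mathcal{D}$ to subsets (not necessarily finite) of $\operatorname{Ob}(\mathcal{D})$ such that for every $d,x\in\mathcal{D}$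 there exists $y\in\mu(d)$ with $x\leq_d y$. It is not assumed in general that the hom-sets of $\mathcal{D}$ are finite or that $k$ is Artinian. For a family of objects, $\mu(\{d_i\}_{i\in I})=\bigcup_{i\in I}\mu(d_i)$, and $\mu^p$ denotes the $p$-fold self-composition of this operation, with $\mu^0(\{d_i\}_{i\in I})=\{d_i\}_{i\in I}$. The full subcategory spanned by a collection of objects is the largest subcategory containing only those objects.
   Formalization: The finite-generation assertion additionally assumes that μ(x) is finite for every x in μ^p({d_i}) with p < q; without this it is false already for q = 1 (0→i poset, μ(x)=Ob(D), Ext^1 an infinite product). The isomorphism is proved with no such assumption. *)

(* Defs.v *)
From HB Require Import structures.
From mathcomp Require Import all_boot all_order all_algebra.
From mathcomp Require Import all_classical.

Set Implicit Arguments.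
Unset Strict Implicit.
Unset Printing Implicit Defensive.

Import GRing.Theory.
Local Open Scope classical_set_scope.
Local Open Scope ring_scope.
Local Open Scope quotient_scope.

Definition lmod_iso (k : pzRingType) (M N : lmodType k) : Prop :=
  exists f : {linear M -> N}, bijective f.

Definition fg_mod (k : pzRingType) (M : lmodType k) : Prop :=
  exists n (b : 'I_n -> M), forall v : M,
    exists c : 'I_n -> k, v = \sum_(i < n) c i *: b i.

(* Every ideal of [k] is finitely generated; an ideal is a submodule of the
   regular module [k^o]. *)
Definition noetherian (k : comPzRingType) : Prop :=
  forall J : {pred k^o}, GRing.submod_closed J ->
  exists n (b : 'I_n -> k), (forall i, b i \in J) /\
    forall a, a \in J -> exists c : 'I_n -> k, a = \sum_(i < n) c i * b i.

Lemma linear_ext (k : pzRingType) (M N : lmodType k) (f g : {linear M -> N}) :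
  f =1 g -> f = g.
Proof.
case: f => f [[f1] [f2]]; case: g => g [[g1] [g2]] /= /funext fg.
rewrite -{}fg in g1 g2 *.
by rewrite (Prop_irrelevance g1 f1) (Prop_irrelevance g2 f2).
Qed.

Section Kernel.
Variables (k : pzRingType) (M N : lmodType k) (f : {linear M -> N}).

Definition ker_pred : {pred M} := [pred v | f v == 0].

Record kermod := Kermod { kermod_val : M; _ : kermod_val \in ker_pred }.

HB.instance Definition _ := [isSub for kermod_val].
HB.instance Definition _ := [Choice of kermod by <:].

Lemma ker_pred_closed : GRing.subsemimod_closed ker_pred.
Proof.
split; [split|] => [|u v|a v]; rewrite !inE ?linear0 //.
  by rewrite linearD => /eqP-> /eqP->; rewrite addr0.
by rewrite linearZ => /eqP-> /=; rewrite scaler0.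
Qed.

HB.instance Definition _ :=
  GRing.SubChoice_isSubLmodule.Build k M ker_pred kermod ker_pred_closed.

Lemma kermodP (u : kermod) : f (val u) = 0.
Proof. by apply/eqP; exact: (valP u). Qed.

End Kernel.

Section Homology.
Variables (k : pzRingType) (L M N : lmodType k).
Variables (f : {linear L -> M}) (g : {linear M -> N}).

Definition img_pred : {pred kermod g} :=
  fun z => `[< exists u, f u = val z >].

Lemma img_pred_closed : GRing.submod_closed img_pred.
Proof.
split=> [|a u v]; first by apply/asboolP; exists 0; rewrite !linear0.
move=> /asboolP[u' fu] /asboolP[v' fv]; apply/asboolP; exists (a *: u' + v').
by rewrite !linearP /= fu fv.
Qed.

HB.instance Definition _ := GRing.isZmodClosed.Build (kermod g) img_pred
  (conj img_pred_closed.1 (GRing.linear_closedB img_pred_closed.2)).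

(* Meant for [g \o f = 0]; the homology at [M] of [L -> M -> N]. *)
Definition homology := Quotient.quot img_pred.

HB.instance Definition _ := GRing.Zmodule.on homology.
HB.instance Definition _ := EqQuotient.on homology.

Definition homology_scale (a : k) (z : homology) : homology :=
  \pi_homology (a *: repr z).

Lemma homology_scaleE a z :
  homology_scale a (\pi_homology z) = \pi_homology (a *: z).
Proof.
apply/eqP; rewrite /homology_scale -Quotient.idealrBE -scalerBr.
rewrite -[_ *: _]addr0; apply: img_pred_closed.2 img_pred_closed.1.
by rewrite Quotient.idealrBE reprK.
Qed.

Lemma homology_scaleA a b z :
  homology_scale a (homology_scale b z) = homology_scale (a * b) z.
Proof.
elim/quotW: z => z.
by rewrite [homology_scale b _]homology_scaleE 2!homology_scaleE scalerA.
Qed.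

Lemma homology_scale1 : left_id 1 homology_scale.
Proof. by elim/quotW => z; rewrite homology_scaleE scale1r. Qed.

Lemma homology_scaleDr : right_distributive homology_scale +%R.
Proof.
move=> a; elim/quotW => y; elim/quotW => z.
by rewrite -raddfD 3!homology_scaleE scalerDr raddfD.
Qed.

Lemma homology_scaleDl z : {morph homology_scale^~ z : a b / a + b}.
Proof.
by elim/quotW: z => z a b; rewrite 3!homology_scaleE scalerDl raddfD.
Qed.

HB.instance Definition _ := GRing.Zmodule_isLmodule.Build k homology
  homology_scaleA homology_scale1 homology_scaleDr homology_scaleDl.

End Homology.

Record category := Category {
  Ob :> Type;
  Mor : Ob -> Ob -> Type;
  id_mor : forall x, Mor x x;
  comp_mor : forall x y z, Mor y z -> Mor x y -> Mor x z;
  comp1m : forall x y (f : Mor x y), comp_mor (id_mor y) f = f;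
  compm1 : forall x y (f : Mor x y), comp_mor f (id_mor x) = f;
  compA : forall w x y z (h : Mor y z) (g : Mor x y) (f : Mor w x),
    comp_mor h (comp_mor g f) = comp_mor (comp_mor h g) f }.

Arguments Mor {c} x y.
Arguments id_mor {c} x.
Arguments comp_mor {c x y z} g f.

Definition full_subcat (D : category) (A : set D) : category :=
  @Category {x : D | A x} (fun x y => Mor (sval x) (sval y))
    (fun x => id_mor (sval x)) (fun x y z g f => comp_mor g f)
    (fun x y f => comp1m f) (fun x y f => compm1 f)
    (fun w x y z h g f => compA h g f).

Record rep (k : comPzRingType) (D : category) := Rep {
  rep_ob :> D -> lmodType k;
  rep_map : forall x y, Mor x y -> {linear rep_ob x -> rep_ob y};
  rep_map1 : forall x v, rep_map (id_mor x) v = v;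
  rep_mapM : forall x y z (g : Mor y z) (f : Mor x y) v,
    rep_map (comp_mor g f) v = rep_map g (rep_map f v) }.

Arguments rep_map {k D} V {x y} f : rename.

Definition restrict_rep (k : comPzRingType) (D : category) (A : set D)
    (V : rep k D) : rep k (full_subcat A) :=
  @Rep k (full_subcat A) (fun x => V (sval x))
    (fun x y (f : @Mor (full_subcat A) x y) => rep_map V f)
    (fun x => @rep_map1 k D V (sval x))
    (fun x y z => @rep_mapM k D V (sval x) (sval y) (sval z)).

Section NatTrans.
Variables (k : comPzRingType) (D : category).

Record nat_trans (V W : rep k D) := NatTrans {
  nt_fun :> forall x, {linear V x -> W x};
  nt_nat : forall x y (f : Mor x y) v,
    nt_fun y (rep_map V f v) = rep_map W f (nt_fun x v) }.

Lemma nat_trans_ext (V W : rep k D) (f g : nat_trans V W) :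
  (forall x, f x =1 g x) -> f = g.
Proof.
case: f g => f fn [g gn] /= fg.
have {}fg : f = g.
  by apply: functional_extensionality_dep => x; apply/linear_ext/fg.
by subst g; rewrite (Prop_irrelevance fn gn).
Qed.

Lemma nt_comp_nat (U V W : rep k D) (g : nat_trans V W) (f : nat_trans U V)
    x y (h : Mor x y) v :
  (g y \o f y) (rep_map U h v) = rep_map W h ((g x \o f x) v).
Proof. by rewrite /= !nt_nat. Qed.

Definition nt_comp (U V W : rep k D) (g : nat_trans V W) (f : nat_trans U V) :
  nat_trans U W := NatTrans (nt_comp_nat g f).

Section HomModule.
Variables V W : rep k D.

HB.instance Definition _ := gen_eqMixin (nat_trans V W).
HB.instance Definition _ := gen_choiceMixin (nat_trans V W).

Implicit Types f g h : nat_trans V W.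

Fact nt_zero_nat x y (h : Mor x y) v :
  (\0 : V y -> W y) (rep_map V h v) = rep_map W h ((\0 : V x -> W x) v).
Proof. by rewrite /= linear0. Qed.
Definition nt_zero : nat_trans V W := NatTrans nt_zero_nat.

Fact nt_opp_nat f x y (h : Mor x y) v :
  (\- f y) (rep_map V h v) = rep_map W h ((\- f x) v).
Proof. by rewrite /= nt_nat linearN. Qed.
Definition nt_opp f : nat_trans V W := NatTrans (nt_opp_nat f).

Fact nt_add_nat f g x y (h : Mor x y) v :
  (f y \+ g y) (rep_map V h v) = rep_map W h ((f x \+ g x) v).
Proof. by rewrite /= !nt_nat linearD. Qed.
Definition nt_add f g : nat_trans V W := NatTrans (nt_add_nat f g).

Fact nt_scale_nat (a : k) f x y (h : Mor x y) v :
  (a \*: f y) (rep_map V h v) = rep_map W h ((a \*: f x) v).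
Proof. by rewrite /= nt_nat linearZ. Qed.
Definition nt_scale (a : k) f : nat_trans V W := NatTrans (nt_scale_nat a f).

Fact nt_addA : associative nt_add.
Proof. by move=> f g h; apply: nat_trans_ext => x v /=; rewrite addrA. Qed.
Fact nt_addC : commutative nt_add.
Proof. by move=> f g; apply: nat_trans_ext => x v /=; rewrite addrC. Qed.
Fact nt_add0 : left_id nt_zero nt_add.
Proof. by move=> f; apply: nat_trans_ext => x v /=; rewrite add0r. Qed.
Fact nt_addN : left_inverse nt_zero nt_opp nt_add.
Proof. by move=> f; apply: nat_trans_ext => x v /=; rewrite addNr. Qed.

HB.instance Definition _ :=
  GRing.isZmodule.Build (nat_trans V W) nt_addA nt_addC nt_add0 nt_addN.

Fact nt_scaleA a b f : nt_scale a (nt_scale b f) = nt_scale (a * b) f.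
Proof. by apply: nat_trans_ext => x v /=; rewrite scalerA. Qed.
Fact nt_scale1 : left_id 1 nt_scale.
Proof. by move=> f; apply: nat_trans_ext => x v /=; rewrite scale1r. Qed.
Fact nt_scaleDr : right_distributive nt_scale +%R.
Proof. by move=> a f g; apply: nat_trans_ext => x v /=; rewrite scalerDr. Qed.
Fact nt_scaleDl f : {morph nt_scale^~ f : a b / a + b}.
Proof. by move=> a b; apply: nat_trans_ext => x v /=; rewrite scalerDl. Qed.

HB.instance Definition _ := GRing.Zmodule_isLmodule.Build k (nat_trans V W)
  nt_scaleA nt_scale1 nt_scaleDr nt_scaleDl.

End HomModule.

Definition precomp (U V W : rep k D) (f : nat_trans U V) (g : nat_trans V W) :
  nat_trans U W := nt_comp g f.

Fact precomp_linear (U V W : rep k D) (f : nat_trans U V) :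
  linear (@precomp U V W f).
Proof. by move=> a g h; apply: nat_trans_ext. Qed.

HB.instance Definition _ (U V W : rep k D) (f : nat_trans U V) :=
  GRing.isLinear.Build k (nat_trans V W) (nat_trans U W) _ (@precomp U V W f)
    (@precomp_linear U V W f).

End NatTrans.

Section Ext.
Variables (k : comPzRingType) (D : category).

(* Epimorphisms of representations are the objectwise surjective maps. *)
Definition projective (P : rep k D) : Prop :=
  forall (A B : rep k D) (p : nat_trans A B) (f : nat_trans P B),
    (forall x (b : B x), exists a, p x a = b) ->
    exists g : nat_trans P A, nt_comp p g = f.

Record proj_resolution (V : rep k D) := ProjResolution {
  pr_ob :> nat -> rep k D;
  pr_d : forall n, nat_trans (pr_ob n.+1) (pr_ob n);
  pr_aug : nat_trans (pr_ob 0) V;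
  pr_proj : forall n, projective (pr_ob n);
  pr_aug_surj : forall x (v : V x), exists u, pr_aug x u = v;
  pr_aug_exact : forall x (v : pr_ob 0 x),
    pr_aug x v = 0 <-> exists u, pr_d 0 x u = v;
  pr_exact : forall n x (v : pr_ob n.+1 x),
    pr_d n x v = 0 <-> exists u, pr_d n.+1 x u = v }.

(* The cohomology in degree [q] of the complex of natural transformations from
   [P] to [W], with the zero map entering degree 0. *)
Definition Ext_res (V : rep k D) (P : proj_resolution V) (q : nat)
    (W : rep k D) : lmodType k :=
  match q with
  | 0 => homology (\0 : {linear nat_trans (P 0) W -> nat_trans (P 0) W})
                  (@precomp k D _ _ W (pr_d P 0))
  | p.+1 => homology (@precomp k D _ _ W (pr_d P p))
                     (@precomp k D _ _ W (pr_d P p.+1))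
  end.

End Ext.

(* The free module on [T]: the functions [T -> k] of finite support. *)
Section FreeModule.
Variables (k : comPzRingType) (T : Type).

Definition fm_delta (t : T) : T -> k^o := fun u => `[< t = u >]%:R.

Definition fm_eval (M : lmodType k) (h : T -> M) (s : seq (k * T)) : M :=
  \sum_(c <- s) c.1 *: h c.2.

Definition fm_pred : {pred T -> k^o} :=
  fun f => `[< exists s, fm_eval fm_delta s = f >].

Record freemod := Freemod {
  freemod_val : T -> k^o;
  _ : freemod_val \in fm_pred }.

HB.instance Definition _ := [isSub for freemod_val].
HB.instance Definition _ := [Choice of freemod by <:].

Definition fm_smul (a : k) (s : seq (k * T)) := [seq (a * c.1, c.2) | c <- s].

Lemma fm_eval_cat (M : lmodType k) (h : T -> M) s1 s2 :
  fm_eval h (s1 ++ s2) = fm_eval h s1 + fm_eval h s2.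
Proof. by rewrite /fm_eval big_cat. Qed.

Lemma fm_eval_smul (M : lmodType k) (h : T -> M) a s :
  fm_eval h (fm_smul a s) = a *: fm_eval h s.
Proof.
rewrite /fm_eval big_map scaler_sumr; apply: eq_bigr => c _ /=.
by rewrite scalerA.
Qed.

Lemma fm_pred_closed : GRing.subsemimod_closed fm_pred.
Proof.
split; [split|] => [|u v|a v].
- by apply/asboolP; exists [::]; rewrite /fm_eval big_nil.
- move=> /asboolP[s <-] /asboolP[s' <-]; apply/asboolP.
  by exists (s ++ s'); rewrite fm_eval_cat.
- by move=> /asboolP[s <-]; apply/asboolP; exists (fm_smul a s);
    rewrite fm_eval_smul.
Qed.

HB.instance Definition _ :=
  GRing.SubChoice_isSubLmodule.Build k (T -> k^o) fm_pred freemod fm_pred_closed.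

Lemma fm_gen_subproof t : fm_delta t \in fm_pred.
Proof.
by apply/asboolP; exists [:: (1, t)]; rewrite /fm_eval big_seq1 scale1r.
Qed.

Definition fm_gen (t : T) : freemod := Freemod (fm_gen_subproof t).

Lemma fm_eval0 (M : lmodType k) (h : T -> M) s :
  fm_eval fm_delta s = 0 -> fm_eval h s = 0.
Proof.
move=> s0; rewrite /fm_eval.
pose r : seq {classic T} := undup [seq c.2 : {classic T} | c <- s].
have -> : \sum_(c <- s) c.1 *: h c.2 =
    \sum_(c <- s) \sum_(t <- r | t == c.2 :> {classic T}) c.1 *: h t.
  rewrite !(@big_seq _ _ _ {classic k * T}); apply: eq_bigr => c cs.
  have cr : (c.2 : {classic T}) \in r.
    by rewrite mem_undup (@map_f {classic k * T} {classic T} snd).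
  rewrite big_mkcond (bigD1_seq (c.2 : {classic T})) ?undup_uniq //= eqxx.
  by rewrite big1 ?addr0 // => t /negPf->.
rewrite (exchange_big_dep xpredT) //= big1 // => t _.
rewrite -scaler_suml [X in X *: _](_ : _ = 0) ?scale0r //.
transitivity (fm_eval fm_delta s t); last by rewrite s0.
rewrite /fm_eval fct_sumE /= [LHS]big_mkcond /=.
apply: eq_bigr => c _; rewrite -[RHS]/(c.1 * `[< c.2 = t >]%:R).
case: eqP => [->|ntc]; first by rewrite asboolT ?mulr1.
by rewrite asboolF ?mulr0 // => /esym.
Qed.

Lemma fm_eval_eq (M : lmodType k) (h : T -> M) s1 s2 :
  fm_eval fm_delta s1 = fm_eval fm_delta s2 -> fm_eval h s1 = fm_eval h s2.
Proof.
move=> s12; apply/eqP; rewrite -subr_eq0 -scaleN1r -fm_eval_smul -fm_eval_cat.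
by apply/eqP/fm_eval0; rewrite fm_eval_cat fm_eval_smul scaleN1r s12 subrr.
Qed.

Lemma fm_reprP (f : freemod) : exists s, fm_eval fm_delta s = val f.
Proof. by have /asboolP := valP f. Qed.

Definition fm_repr (f : freemod) : seq (k * T) := sval (cid (fm_reprP f)).

Lemma fm_reprE f : fm_eval fm_delta (fm_repr f) = val f.
Proof. exact: svalP (cid (fm_reprP f)). Qed.

Definition fm_lift (M : lmodType k) (h : T -> M) (f : freemod) : M :=
  fm_eval h (fm_repr f).

Lemma fm_lift_linear (M : lmodType k) (h : T -> M) : linear (fm_lift h).
Proof.
move=> a f g; rewrite -fm_eval_smul -fm_eval_cat; apply: fm_eval_eq.
by rewrite fm_eval_cat fm_eval_smul !fm_reprE.
Qed.

HB.instance Definition _ (M : lmodType k) (h : T -> M) :=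
  GRing.isLinear.Build k freemod M _ (fm_lift h) (fm_lift_linear h).

Lemma fm_liftE (M : lmodType k) (h : T -> M) t : fm_lift h (fm_gen t) = h t.
Proof.
transitivity (fm_eval h [:: (1, t)]); last by rewrite /fm_eval big_seq1 scale1r.
by apply: fm_eval_eq; rewrite fm_reprE /fm_eval big_seq1 scale1r.
Qed.

Lemma fm_linear_eq (M : lmodType k) (f g : {linear freemod -> M}) :
  (forall t, f (fm_gen t) = g (fm_gen t)) -> f =1 g.
Proof.
move=> fg u.
have -> : u = fm_eval fm_gen (fm_repr u).
  apply: val_inj; rewrite -fm_reprE /fm_eval raddf_sum.
  by apply: eq_bigr => c _.
rewrite /fm_eval !linear_sum; apply: eq_bigr => c _.
by rewrite 2!linearZ_LR fg.
Qed.

End FreeModule.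

Section FreeCover.
Variables (k : comPzRingType) (D : category) (V : rep k D).

Record cover_basis (x : D) := CoverBasis {
  cb_ob : D;
  cb_vec : V cb_ob;
  cb_hom : Mor cb_ob x }.

Definition cb_map x y (f : Mor x y) (t : cover_basis x) : cover_basis y :=
  CoverBasis (cb_vec t) (comp_mor f (cb_hom t)).

Definition cover_map x y (f : Mor x y) :
    {linear freemod k (cover_basis x) -> freemod k (cover_basis y)} :=
  fm_lift (fun t => fm_gen k (cb_map f t)).

Lemma cover_map1 x u : cover_map (id_mor x) u = u.
Proof.
apply: (fm_linear_eq (g := idfun)) => -[d v h].
by rewrite /cover_map /= fm_liftE /cb_map /= comp1m.
Qed.

Lemma cover_mapM x y z (g : Mor y z) (f : Mor x y) u :
  cover_map (comp_mor g f) u = cover_map g (cover_map f u).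
Proof.
apply: (fm_linear_eq (g := cover_map g \o cover_map f)) => -[d v h].
by rewrite /cover_map /= !fm_liftE /cb_map /= compA.
Qed.

(* The direct sum of the [k Mor(d, -)] over all objects [d] and [v] in [V d]. *)
Definition free_cover : rep k D := Rep cover_map1 cover_mapM.

Definition cover_aug_fun x : {linear free_cover x -> V x} :=
  fm_lift (fun t : cover_basis x => rep_map V (cb_hom t) (cb_vec t)).

Lemma cover_aug_nat x y (f : Mor x y) u :
  cover_aug_fun y (rep_map free_cover f u) = rep_map V f (cover_aug_fun x u).
Proof.
apply: (fm_linear_eq (f := cover_aug_fun y \o cover_map f)
                     (g := rep_map V f \o cover_aug_fun x)) => -[d v h].
by rewrite /cover_aug_fun /cover_map /= !fm_liftE /= rep_mapM.
Qed.

Definition cover_aug : nat_trans free_cover V := NatTrans cover_aug_nat.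

Lemma cover_aug_surj x (v : V x) : exists u, cover_aug x u = v.
Proof.
by exists (fm_gen k (CoverBasis v (id_mor x))); rewrite /= fm_liftE /= rep_map1.
Qed.

Lemma free_cover_proj : projective free_cover.
Proof.
move=> A B p f psurj.
pose h d (v : V d) : A d :=
  sval (cid (psurj d (f d (fm_gen k (CoverBasis v (id_mor d)))))).
have hE d v : p d (h d v) = f d (fm_gen k (CoverBasis v (id_mor d))).
  exact: svalP (cid (psurj _ _)).
pose g x : {linear free_cover x -> A x} :=
  fm_lift (fun t : cover_basis x => rep_map A (cb_hom t) (h _ (cb_vec t))).
have gnat x y (m : Mor x y) u :
    g y (rep_map free_cover m u) = rep_map A m (g x u).
  apply: (fm_linear_eq (f := g y \o cover_map m)
                       (g := rep_map A m \o g x)) => -[d v c].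
  by rewrite /g /cover_map /= !fm_liftE /= rep_mapM.
exists (NatTrans gnat); apply: nat_trans_ext => x.
apply: (fm_linear_eq (f := p x \o g x) (g := f x)) => -[d v c].
rewrite /g /= fm_liftE /= nt_nat hE -nt_nat /= fm_liftE /cb_map /=.
by rewrite compm1.
Qed.

End FreeCover.

Section KernelRep.
Variables (k : comPzRingType) (D : category) (V W : rep k D).
Variable f : nat_trans V W.

Lemma ker_map_subproof x y (h : Mor x y) (u : kermod (f x)) :
  rep_map V h (val u) \in ker_pred (f y).
Proof. by rewrite inE nt_nat kermodP linear0. Qed.

Definition ker_map x y (h : Mor x y) (u : kermod (f x)) : kermod (f y) :=
  Kermod (ker_map_subproof h u).

Lemma ker_map_linear x y (h : Mor x y) : linear (ker_map h).
Proof. by move=> a u v; apply: val_inj; rewrite /= linearP. Qed.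

HB.instance Definition _ x y (h : Mor x y) :=
  GRing.isLinear.Build k (kermod (f x)) (kermod (f y)) _ (ker_map h)
    (ker_map_linear h).

Lemma ker_map1 x (u : kermod (f x)) : ker_map (id_mor x) u = u.
Proof. by apply: val_inj; rewrite /= rep_map1. Qed.

Lemma ker_mapM x y z (g : Mor y z) (h : Mor x y) (u : kermod (f x)) :
  ker_map (comp_mor g h) u = ker_map g (ker_map h u).
Proof. by apply: val_inj; rewrite /= rep_mapM. Qed.

Definition ker_rep : rep k D :=
  @Rep k D (fun x => kermod (f x)) (fun x y h => ker_map h) ker_map1 ker_mapM.

Definition ker_incl_fun x : {linear ker_rep x -> V x} := val.

Lemma ker_incl_nat x y (h : Mor x y) u :
  ker_incl_fun y (rep_map ker_rep h u) = rep_map V h (ker_incl_fun x u).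
Proof. by []. Qed.

Definition ker_incl : nat_trans ker_rep V := NatTrans ker_incl_nat.

End KernelRep.

Section FreeResolution.
Variables (k : comPzRingType) (D : category) (V : rep k D).

Fixpoint syzygy (n : nat) : rep k D :=
  if n is p.+1 then ker_rep (cover_aug (syzygy p)) else V.

Definition free_res_d n :
    nat_trans (free_cover (syzygy n.+1)) (free_cover (syzygy n)) :=
  nt_comp (ker_incl (cover_aug (syzygy n))) (cover_aug (syzygy n.+1)).

Lemma free_res_exact n x (v : free_cover (syzygy n) x) :
  cover_aug (syzygy n) x v = 0 <-> exists u, free_res_d n x u = v.
Proof.
split=> [v0|[u <-]]; last exact: kermodP.
have v0' : v \in ker_pred (cover_aug (syzygy n) x) by rewrite inE v0.
have [u uv] := @cover_aug_surj k D (syzygy n.+1) x (Kermod v0').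
by exists u; rewrite /free_res_d /= [fm_lift _ _]uv.
Qed.

Lemma free_res_d0 n x (v : free_cover (syzygy n.+1) x) :
  free_res_d n x v = 0 <-> cover_aug (syzygy n.+1) x v = 0.
Proof.
split=> [v0|v0]; first exact: val_inj.
by rewrite /free_res_d /= [fm_lift _ _]v0.
Qed.

Definition free_resolution : proj_resolution V :=
  @ProjResolution k D V (fun n => free_cover (syzygy n)) free_res_d
    (cover_aug V) (fun n => @free_cover_proj k D (syzygy n))
    (@cover_aug_surj k D V) (@free_res_exact 0)
    (fun n x v => iff_trans (free_res_d0 v) (@free_res_exact n.+1 x v)).

End FreeResolution.

(* Ext is independent, up to isomorphism, of the projective resolution. *)
Definition Ext (k : comPzRingType) (D : category) (q : nat) (V W : rep k D) :
  lmodType k := Ext_res (free_resolution V) q W.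

Section Generation.
Variables (k : comPzRingType) (D : category) (V : rep k D).

Definition subrep (U : forall x, {pred V x}) : Prop :=
  (forall x, GRing.submod_closed (U x)) /\
  (forall x y (f : Mor x y) v, v \in U x -> rep_map V f v \in U y).

Definition generated_in (I : Type) (d : I -> D) : Prop :=
  forall U : forall x, {pred V x}, subrep U ->
    (forall i (v : V (d i)), v \in U (d i)) -> forall x (v : V x), v \in U x.

Definition fg_rep : Prop :=
  exists l (e : 'I_l -> D), generated_in e /\ forall j, fg_mod (V (e j)).

End Generation.

Section Modulus.
Variables (k : comPzRingType) (D : category).

Definition factors_through (x y : D) : set (Mor x x) :=
  [set s | exists (a : Mor x y) (b : Mor y x), s = comp_mor b a].

(* The 0-1 matrix [M_s]; its index set need not be finite. *)
Definition action_mx (d x : D) (s : Mor x x) (f g : Mor d x) : k :=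
  if `[< comp_mor s f = g >] then 1 else 0.

Definition id_mx (d x : D) (f g : Mor d x) : k :=
  if `[< f = g >] then 1 else 0.

Definition le_at (d x y : D) : Prop :=
  exists n (s : 'I_n -> Mor x x) (c : 'I_n -> k),
    (forall i, factors_through y (s i)) /\
    forall f g : Mor d x, id_mx f g = \sum_(i < n) c i * action_mx (s i) f g.

Definition homological_modulus (mu : D -> set D) : Prop :=
  forall d x, exists2 y, mu d y & le_at d x y.

Definition modulus_iter (mu : D -> set D) (p : nat) (A : set D) : set D :=
  iter p (fun B => \bigcup_(x in B) mu x) A.

End Modulus.

(* Main.v *)
Require Import Defs.
From Stdlib Require List.
From HB Require Import structures.
From mathcomp Require Import all_boot all_order all_algebra.
From mathcomp Require Import all_classical.

Set Implicit Arguments.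
Unset Strict Implicit.
Unset Printing Implicit Defensive.

(** Everything rests on one observation about syzygies (lemma [ker_generated]):
    if [P] is a free representation on generators in degrees [deg t], then the
    kernel of any map out of [P] is generated in the degrees
    [\bigcup_t mu (deg t)].  Indeed [x <=_d y] says that the identity of [x]
    acts on [k Mor(d, x)] as a combination [e] of endomorphisms factoring through
    [y].  For a kernel element [u] at [x], the element [e u] is
    pushed forward from the kernel at [y], while [u - e u] lies in the kernel
    again and has lost its component in [k Mor(d, x)]; removing the finitely many
    components of [u] one after the other exhausts [u].

    Consequently [V] has a resolution whose [p]-th syzygy is generated in degrees
    [mu^p(d)] and whose [p]-th term is free on generators in these degrees.
    Restricted to the full subcategory [E] it stays exact, and as long as the
    generators lie in [E] it stays projective ([restrict_free_proj]).  Moreover a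
    representation generated in degrees [B] has relations in degrees [mu(B)], so
    natural transformations out of it are the same on [D] and on [E] as soon as
    [E] contains [B] and [mu(B)] ([restrict_inj], [restrict_full]).

    To compare with the canonical resolutions that define [Ext], without splicing
    resolutions that are projective only in low degrees, [Ext^q(V, W)] is
    written as [Hom(K, W)] modulo the maps that extend along [K -> I], where
    [K] is the [q]-th syzygy inside its ambient projective [I] ([Ext_quot]).  An
    iterated form of Schanuel's lemma ([step_equiv]) shows that the pair
    [K -> I] is determined up to homotopy equivalence by [V] and [q], and
    the quotient only depends on the homotopy type ([equiv_quot]).  Taking for
    [K] the syzygy generated in degrees [mu^q(d)] and its restriction to [E]
    gives the isomorphism; the index [q + 1] in the definition of [E] is what
    puts the relations of [K] in [E].

    For finite generation, finitely many vectors suffice at each stage:  the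
    values of a free representation on finitely many generators are finitely
    generated when the relevant hom-sets are finite, so by noetherianity the
    kernel has finitely generated values in its finitely many generating degrees
    ([fin_gen_stage]).  Then [Hom(K, W)] embeds in a finite product of values of
    [W], by evaluation at finitely many generators of [K] ([Ext_fg]). *)

Import GRing.Theory.
Local Open Scope classical_set_scope.
Local Open Scope ring_scope.

(** * Modules presented as quotients *)

(** A relation rather than a construction: the same quotient is met as several
    non-equal modules (homology of different complexes), and only its universal
    description is used. *)
Definition quot_by (k : pzRingType) (A : lmodType k) (B : A -> Prop)
    (Q : lmodType k) : Prop :=
  exists pi : {linear A -> Q},
    (forall z, exists a, pi a = z) /\ (forall a, pi a = 0 <-> B a).

Section QuotBy.
Variable k : pzRingType.
Implicit Types A M N Q : lmodType k.

Lemma quot_by_unique A B Q Q' :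
  @quot_by k A B Q -> quot_by B Q' -> lmod_iso Q Q'.
Proof.
move=> [p [ps pk]] [p' [ps' pk']].
pose s z := sval (cid (ps z)).
have sK z : p (s z) = z by exact: svalP (cid (ps z)).
have pp' a b : p a = p b -> p' a = p' b.
  move=> /eqP; rewrite -subr_eq0 -linearB => /eqP/pk/pk'.
  by rewrite linearB => /eqP; rewrite subr_eq0 => /eqP.
have p'p a b : p' a = p' b -> p a = p b.
  move=> /eqP; rewrite -subr_eq0 -linearB => /eqP/pk'/pk.
  by rewrite linearB => /eqP; rewrite subr_eq0 => /eqP.
have lin : linear (fun z => p' (s z)).
  by move=> a u v /=; rewrite -linearP; apply: pp'; rewrite linearP !sK.
pose h := GRing.isLinear.Build k Q Q' _ (fun z => p' (s z)) lin.
pose f : {linear Q -> Q'} := HB.pack (fun z => p' (s z)) h.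
exists f; exists (fun z => p (sval (cid (ps' z)))) => z /=.
  by case: cid => a /= /p'p ->.
by case: cid => a /= <-; apply: pp'; rewrite sK.
Qed.

Lemma quot_by_transfer A A' (B : A -> Prop) B' Q (f : {linear A -> A'}) :
  (forall a, B a <-> B' (f a)) -> (forall a', exists a, B' (a' - f a)) ->
  quot_by B' Q -> quot_by B Q.
Proof.
move=> BB' fs [p [ps pk]]; exists (p \o f); split=> [z|a /=].
  have [a' <-] := ps z; have [a /pk] := fs a'.
  by rewrite linearB => /eqP; rewrite subr_eq0 => /eqP ->; exists a.
by rewrite BB'; exact: pk.
Qed.

Lemma quot_by_ext A (B B' : A -> Prop) Q :
  (forall a, B a <-> B' a) -> quot_by B Q -> quot_by B' Q.
Proof.
by move=> BB' [p [ps pk]]; exists p; split=> // a; rewrite pk; exact: BB'.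
Qed.

(** With [A] playing the part of the cycles, this turns a cohomology module
    into a quotient of a more convenient copy of its cycles. *)
Lemma quot_by_homology A (L M N : lmodType k) (f : {linear L -> M})
    (g : {linear M -> N}) (j : {linear A -> M}) :
  injective j -> (forall m, g m = 0 <-> exists a, j a = m) ->
  quot_by (fun a => exists l, f l = j a) (homology f g).
Proof.
move=> ji jk.
have jker a : j a \in ker_pred g by rewrite inE; apply/eqP/jk; exists a.
pose p a : homology f g := \pi_(homology f g)%qT (Kermod (jker a)).
have lin : linear p.
  move=> a u v.
  have -> : p (a *: u + v) =
      (\pi_(homology f g) (a *: Kermod (jker u) + Kermod (jker v)))%qT.
    by congr (\pi _)%qT; apply: val_inj; rewrite /= linearP.
  rewrite raddfD; congr (_ + _).
  exact: (esym (homology_scaleE f a (Kermod (jker u)))).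
pose h := GRing.isLinear.Build k A (homology f g) _ p lin.
pose pl : {linear A -> homology f g} := HB.pack p h.
exists pl; split=> [|a].
  elim/quotW => -[m mk].
  have /jk[a am] : g m = 0 by apply/eqP; move: mk; rewrite inE.
  by exists a; congr (\pi _)%qT; apply: val_inj.
rewrite /= /p; split=> [/eqP|fa].
  rewrite -(raddf0 (\pi_(homology f g))%qT) -Quotient.idealrBE subr0.
  by move/asboolP.
apply/eqP; rewrite -(raddf0 (\pi_(homology f g))%qT) -Quotient.idealrBE subr0.
exact/asboolP.
Qed.

End QuotBy.

(** * Free representations *)

Lemma nt_compE (k : comPzRingType) (D : category) (U V W : rep k D)
    (g : nat_trans V W) (f : nat_trans U V) x u :
  nt_comp g f x u = g x (f x u).
Proof. by []. Qed.

Lemma freemod_sum (k : comPzRingType) (T : Type) (u : freemod k T) :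
  \sum_(c <- fm_repr u) c.1 *: fm_gen k c.2 = u.
Proof.
apply: val_inj; rewrite -[RHS]fm_reprE /fm_eval raddf_sum.
by apply: eq_bigr => c _.
Qed.

Section FreeOn.
Variables (k : comPzRingType) (D : category) (T : Type) (deg : T -> D).

Definition free_basis (x : D) := {t : T & Mor (deg t) x}.

Definition free_basis_map x y (f : Mor x y) (b : free_basis x) : free_basis y :=
  existT _ (tag b) (comp_mor f (tagged b)).

Definition free_on_map x y (f : Mor x y) :
    {linear freemod k (free_basis x) -> freemod k (free_basis y)} :=
  fm_lift (fun b => fm_gen k (free_basis_map f b)).

Lemma free_on_map1 x u : free_on_map (id_mor x) u = u.
Proof.
apply: (fm_linear_eq (g := idfun)) => -[t h].
by rewrite /free_on_map /= fm_liftE /free_basis_map /= comp1m.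
Qed.

Lemma free_on_mapM x y z (g : Mor y z) (f : Mor x y) u :
  free_on_map (comp_mor g f) u = free_on_map g (free_on_map f u).
Proof.
apply: (fm_linear_eq (g := free_on_map g \o free_on_map f)) => -[t h].
by rewrite /free_on_map /= !fm_liftE /free_basis_map /= Defs.compA.
Qed.

(** The direct sum of the representables [k Mor(deg t, -)] over [t]. *)
Definition free_on : rep k D := Rep free_on_map1 free_on_mapM.

Definition free_elt x t (h : Mor (deg t) x) : free_on x :=
  fm_gen k (existT _ t h : free_basis x).

Lemma free_on_mapE x y (f : Mor x y) t (h : Mor (deg t) x) :
  rep_map free_on f (free_elt h) = free_elt (comp_mor f h).
Proof. exact: fm_liftE. Qed.

Lemma free_on_linear_eq x (M : lmodType k) (f g : {linear free_on x -> M}) :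
  (forall t (h : Mor (deg t) x), f (free_elt h) = g (free_elt h)) -> f =1 g.
Proof. by move=> fg; apply: fm_linear_eq => -[t h]; exact: fg. Qed.

Lemma free_on_ind x (Q : free_on x -> Prop) :
  Q 0 -> (forall a u v, Q u -> Q v -> Q (a *: u + v)) ->
  (forall t (h : Mor (deg t) x), Q (free_elt h)) -> forall u, Q u.
Proof.
move=> Q0 QP Qelt u; have <- := freemod_sum u.
elim: (fm_repr u) => [|[c [t h]] s IH]; first by rewrite big_nil.
by rewrite big_cons; apply: QP => //=; exact: Qelt.
Qed.

Section FreeMap.
Variables (V : rep k D) (v : forall t, V (deg t)).

Definition free_map_fun x : {linear free_on x -> V x} :=
  fm_lift (fun b : free_basis x => rep_map V (tagged b) (v (tag b))).

Lemma free_map_funE x t (h : Mor (deg t) x) :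
  free_map_fun x (free_elt h) = rep_map V h (v t).
Proof. exact: fm_liftE. Qed.

Lemma free_map_nat x y (f : Mor x y) u :
  free_map_fun y (rep_map free_on f u) = rep_map V f (free_map_fun x u).
Proof.
apply: (free_on_linear_eq (f := free_map_fun y \o rep_map free_on f)
                          (g := rep_map V f \o free_map_fun x)) => t h.
by rewrite /= [fm_lift _ (free_elt h)]free_on_mapE !free_map_funE rep_mapM.
Qed.

Definition free_map : nat_trans free_on V := NatTrans free_map_nat.

Lemma free_mapE x t (h : Mor (deg t) x) :
  free_map x (free_elt h) = rep_map V h (v t).
Proof. exact: free_map_funE. Qed.

End FreeMap.

Lemma free_nt_eq (V : rep k D) (f g : nat_trans free_on V) :
  (forall t, f _ (free_elt (id_mor (deg t))) = g _ (free_elt (id_mor _))) ->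
  f = g.
Proof.
move=> fg; apply: nat_trans_ext => x; apply: free_on_linear_eq => t h.
by rewrite -[h]compm1 -free_on_mapE !nt_nat fg.
Qed.

Lemma free_on_proj : projective free_on.
Proof.
move=> A B p f ps.
exists (free_map (fun t => sval (cid (ps _ (f _ (free_elt (id_mor (deg t)))))))).
apply: free_nt_eq => t; rewrite nt_compE free_mapE rep_map1.
exact: svalP (cid (ps _ _)).
Qed.

End FreeOn.

Arguments free_on k {D T} deg.
Arguments free_elt {k D T deg x} t h.

(** * Generation and factorization of natural transformations *)

Section Generation.
Variables (k : comPzRingType) (D : category).
Implicit Types V W P : rep k D.

Definition surj_nt V W (f : nat_trans V W) := forall x w, exists v, f x v = w.

(** The image of [f] is a subrepresentation. *)
Lemma generated_surj V P (I : Type) (d : I -> D) (f : nat_trans P V) :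
  generated_in V d -> (forall i v, exists u, f (d i) u = v) -> surj_nt f.
Proof.
move=> gV fd x v; apply/asboolP.
pose U x : {pred V x} := fun w => `[< exists u, f x u = w >].
apply: (gV U _ _ x v) => [|i w]; last exact/asboolP/fd.
split=> [y|y z h w /asboolP[u <-]]; last first.
  by apply/asboolP; exists (rep_map P h u); rewrite nt_nat.
split=> [|a u w /asboolP[u' <-] /asboolP[w' <-]]; apply/asboolP.
  by exists 0; rewrite linear0.
by exists (a *: u' + w'); rewrite linearP.
Qed.

Lemma generated_cover V (I : Type) (d : I -> D) : generated_in V d ->
  surj_nt (free_map (fun t : {i : I & V (d i)} => tagged t : V (d (tag t)))).
Proof.
move=> gV; apply: (generated_surj gV) => i v.
exists (free_elt (existT (fun i => V (d i) : Type) i v) (id_mor (d i))).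
by rewrite [LHS]free_mapE rep_map1.
Qed.

(** The equalizer of [f] and [g] is a subrepresentation. *)
Lemma generated_eq V W (I : Type) (d : I -> D) (f g : nat_trans V W) :
  generated_in V d -> (forall i v, f (d i) v = g (d i) v) -> f = g.
Proof.
move=> gV fg; apply: nat_trans_ext => x v; apply/eqP.
pose U x : {pred V x} := fun w => f x w == g x w.
apply: (gV U _ _ x v) => [|i w]; last exact/eqP/fg.
split=> [y|y z h w /eqP e]; last by apply/eqP; rewrite !nt_nat e.
split=> [|a u w /eqP eu /eqP ew]; apply/eqP; first by rewrite !linear0.
by rewrite !linearP eu ew.
Qed.

Definition generated_in_set V (B : set D) :=
  generated_in V (fun z : {x | B x} => sval z).

Lemma generated_reindex V (I J : Type) (d : I -> D) (e : J -> D) :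
  (forall i, exists j, e j = d i) -> generated_in V d -> generated_in V e.
Proof.
move=> ed gV U sU UB; apply: gV => // i.
by have [j <-] := ed i; exact: UB.
Qed.

Lemma generated_range V (I : Type) (d : I -> D) :
  generated_in V d -> generated_in_set V (range d).
Proof.
apply: generated_reindex => i.
by exists (exist _ (d i) (ex_intro2 _ _ i Logic.I erefl)).
Qed.

Lemma generated_sub V (B C : set D) :
  B `<=` C -> generated_in_set V B -> generated_in_set V C.
Proof.
move=> BC; apply: generated_reindex => -[x Bx].
by exists (exist _ x (BC x Bx)).
Qed.

Lemma free_on_generated (T : Type) (deg : T -> D) (B : set D) :
  (forall t, B (deg t)) -> generated_in_set (free_on k deg) B.
Proof.
move=> Bd U [sU mU] UB x u.
have [U0 UP] := sU x.
apply: (free_on_ind (Q := fun u => u \in U x)) u => // t h.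
rewrite -[h]compm1 -free_on_mapE; apply: mU.
exact: (UB (exist _ _ (Bd t))).
Qed.

(** [V] is the cokernel of the kernel of [p]. *)
Lemma nt_descend V W P (p : nat_trans P V) (f : nat_trans P W) :
  surj_nt p -> (forall x u, p x u = 0 -> f x u = 0) ->
  exists g : nat_trans V W, nt_comp g p = f.
Proof.
move=> ps pf.
pose s x v := sval (cid (ps x v)).
have sK x v : p x (s x v) = v by exact: svalP (cid (ps x v)).
have ff x u u' : p x u = p x u' -> f x u = f x u'.
  move=> /eqP; rewrite -subr_eq0 -linearB => /eqP/pf.
  by rewrite linearB => /eqP; rewrite subr_eq0 => /eqP.
have lin x : linear (fun v => f x (s x v)).
  by move=> a u v /=; rewrite -linearP; apply: ff; rewrite linearP !sK.
pose h x := GRing.isLinear.Build k (V x) (W x) _ (fun v => f x (s x v)) (lin x).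
pose g x : {linear V x -> W x} := HB.pack (fun v => f x (s x v)) (h x).
have gn x y (m : Mor x y) v : g y (rep_map V m v) = rep_map W m (g x v).
  by rewrite /= -nt_nat; apply: ff; rewrite nt_nat !sK.
by exists (NatTrans gn); apply: nat_trans_ext => x v /=; apply: ff; rewrite sK.
Qed.

Lemma nt_factor_mono K P V (i : nat_trans K P) (f : nat_trans V P) :
  (forall x, injective (i x)) -> (forall x v, exists u, i x u = f x v) ->
  exists g : nat_trans V K, nt_comp i g = f.
Proof.
move=> ii fi.
pose s x v := sval (cid (fi x v)).
have sK x v : i x (s x v) = f x v by exact: svalP (cid (fi x v)).
have lin x : linear (s x).
  by move=> a u v; apply: ii; rewrite linearP !sK linearP.
pose h x := GRing.isLinear.Build k (V x) (K x) _ (s x) (lin x).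
pose g x : {linear V x -> K x} := HB.pack (s x) (h x).
have gn x y (m : Mor x y) v : g y (rep_map V m v) = rep_map K m (g x v).
  by apply: ii; rewrite /= nt_nat !sK nt_nat.
by exists (NatTrans gn); apply: nat_trans_ext => x v /=; rewrite sK.
Qed.

End Generation.

(** * Kernels of maps out of free representations *)

Section Modulus.
Variables (k : comPzRingType) (D : category).

(** Two combinations of basis vectors that agree in the free module on
    [Mor d x] agree in every module, so the matrix identity may be tested against
    an arbitrary [phi]. *)
Lemma le_at_comb (d x y : D) : le_at k d x y ->
  exists n (s : 'I_n -> Mor x x) (c : 'I_n -> k),
    (forall i, factors_through y (s i)) /\
    forall (M : lmodType k) (phi : Mor d x -> M) f,
      phi f = \sum_(i < n) c i *: phi (comp_mor (s i) f).
Proof.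
move=> [n [s [c [sy cs]]]]; exists n, s, c; split=> // M phi f.
transitivity (fm_eval phi [:: (1, f)]).
  by rewrite /fm_eval big_seq1 scale1r.
rewrite (@fm_eval_eq _ _ _ _ _ [seq (c i, comp_mor (s i) f) | i <- enum 'I_n]).
  by rewrite /fm_eval big_map big_enum.
rewrite /fm_eval big_seq1 big_map big_enum scale1r /=.
apply: funext => g; rewrite fct_sumE.
have dE h : fm_delta k h g = if `[< h = g >] then 1 else 0.
  by rewrite /fm_delta; case: asbool.
rewrite dE [LHS](cs f g); apply: eq_bigr => i _.
by rewrite -[RHS]/(c i * fm_delta k (comp_mor (s i) f) g) dE.
Qed.

Variables (mu : D -> set D) (hmu : homological_modulus k mu).
Variables (T : Type) (deg : T -> D).
Let P := free_on k deg.

(** Impredicative, so that linear properties of all elements supported on [L]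
    follow by instantiating [Q], without manipulating coefficient lists. *)
Definition in_span x (L : seq T) (u : P x) :=
  forall Q : P x -> Prop, Q 0 -> (forall a u v, Q u -> Q v -> Q (a *: u + v)) ->
    (forall t h, List.In t L -> Q (free_elt t h)) -> Q u.

Lemma in_span_lin x L a (u v : P x) :
  in_span L u -> in_span L v -> in_span L (a *: u + v).
Proof.
by move=> Lu Lv Q Q0 QP QL; exact: QP (Lu Q Q0 QP QL) (Lv Q Q0 QP QL).
Qed.

Lemma in_span0 x L : in_span L (0 : P x).
Proof. by []. Qed.

Lemma in_span_elt x L t (h : Mor (deg t) x) :
  List.In t L -> in_span L (free_elt t h : P x).
Proof. by move=> tL Q _ _; apply. Qed.

Lemma in_span_mono x L L' (u : P x) :
  (forall t, List.In t L -> List.In t L') -> in_span L u -> in_span L' u.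
Proof. by move=> LL Lu Q Q0 QP QL; apply: Lu => // t h /LL; exact: QL. Qed.

Lemma in_some_span x (u : P x) : exists L, in_span L u.
Proof.
apply: (free_on_ind (Q := fun u => exists L, in_span L u)) u.
- by exists [::].
- move=> a v v' [L Lv] [L' Lv']; exists (L ++ L'); apply: in_span_lin.
    by apply: in_span_mono Lv => t; rewrite List.in_app_iff; left.
  by apply: in_span_mono Lv' => t; rewrite List.in_app_iff; right.
- by move=> t h; exists [:: t]; apply: in_span_elt; left.
Qed.

(** By induction on a finite list [L] of generators supporting [u]: the
    combination [e] of endomorphisms of [x] through [y] that fixes
    [k Mor(deg t, x)] splits [u] as [e u], which comes from the kernel at [y], and
    [u - e u], which is supported on the remaining generators. *)
Lemma ker_generated W (f : nat_trans P W) :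
  generated_in_set (ker_rep f) (\bigcup_(d in range deg) mu d).
Proof.
move=> U [sU mU] UB x [u uk].
have [L Lu] := in_some_span u.
have [U0 UP] := sU x.
elim: L => [|t L IH] in u uk Lu *.
  have u0 : u = 0.
    by apply: (Lu (fun u => u = 0)) => // a v w -> ->; rewrite scaler0 addr0.
  by subst u; rewrite (_ : Kermod _ = 0) //; exact: val_inj.
have [y muy /le_at_comb[n [s [c [sy cs]]]]] := hmu (deg t) x.
pose e (v : ker_rep f x) := \sum_(i < n) c i *: rep_map (ker_rep f) (s i) v.
pose e' (v : P x) := \sum_(i < n) c i *: rep_map P (s i) v.
have e'lin a v w : e' (a *: v + w) = a *: e' v + e' w.
  rewrite /e' scaler_sumr -big_split; apply: eq_bigr => i _ /=.
  by rewrite linearP scalerDr !scalerA mulrC.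
have eE v : val (e v) = e' (val v).
  by rewrite /e raddf_sum.
pose v : ker_rep f x := Kermod uk.
have eU : e v \in U x.
  rewrite /e; elim/big_rec: _ => // i w _ wU; apply: UP => //.
  have [a [b ->]] := sy i; rewrite rep_mapM; apply: mU.
  have By : (\bigcup_(d in range deg) mu d) y by exists (deg t) => //; exists t.
  exact: (UB (exist _ _ By)).
(* The complement of [e] kills the component of [t] and keeps the span of [L]. *)
have rU : v - e v \in U x.
  have -> : v - e v = Kermod (valP (v - e v)) by exact: val_inj.
  apply: IH; rewrite linearB /= eE /=.
  apply: (Lu (fun u => in_span L (u - e' u))).
  - have e0 : e' 0 = 0 by rewrite /e' big1 // => i _; rewrite linear0 scaler0.
    by rewrite e0 subrr.
  - move=> a u1 u2 Lu1 Lu2.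
    by rewrite e'lin opprD addrACA -scalerBr; apply: in_span_lin.
  - move=> t' h [tt'|t'L].
      subst t'; rewrite (_ : e' _ = free_elt t h) ?subrr; first exact: in_span0.
      rewrite [RHS](cs _ (fun h => free_elt t h : P x) h).
      by apply: eq_bigr => i _; rewrite free_on_mapE.
    rewrite -scaleN1r addrC; apply: in_span_lin; last exact: in_span_elt.
    apply: big_ind => [|u1 u2|i _]; first exact: in_span0.
      by move=> L1 L2; rewrite -[u1]scale1r; apply: in_span_lin.
    rewrite free_on_mapE -[_ *: _]addr0.
    by apply: in_span_lin; [exact: in_span_elt|exact: in_span0].
have -> : Kermod uk = 1 *: (v - e v) + e v by rewrite scale1r subrK.
exact: UP.
Qed.


End Modulus.

(** * Restriction to a full subcategory *)

Section Restriction.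
Variables (k : comPzRingType) (D : category) (A : set D).
Implicit Types V W P : rep k D.
Let E := full_subcat A.

Definition restrict_nt V W (f : nat_trans V W) :
    nat_trans (restrict_rep A V) (restrict_rep A W) :=
  @NatTrans k E (restrict_rep A V) (restrict_rep A W) (fun x => f (sval x))
    (fun x y (h : @Mor E x y) v => nt_nat f h v).

Lemma restrict_nt_linear V W : linear (@restrict_nt V W).
Proof. by move=> a f g; apply: nat_trans_ext. Qed.

HB.instance Definition _ V W :=
  GRing.isLinear.Build k (nat_trans V W)
    (nat_trans (restrict_rep A V) (restrict_rep A W)) _ (@restrict_nt V W)
    (@restrict_nt_linear V W).

(** When its generators lie in [A], the restriction of a free representation
    has the same values as the free representation on these generators over the
    subcategory, so identity maps are mutually inverse isomorphisms. *)
Lemma restrict_free_proj (T : Type) (deg : T -> D) :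
  (forall t, A (deg t)) -> projective (restrict_rep A (free_on k deg)).
Proof.
move=> Ad.
pose P := @free_on k E T (fun t => exist _ (deg t) (Ad t)).
pose R := restrict_rep A (free_on k deg).
pose i : nat_trans R P :=
  @NatTrans k E R P (fun x => (idfun : {linear P x -> P x}))
    (fun x y h v => erefl).
pose j : nat_trans P R :=
  @NatTrans k E P R (fun x => (idfun : {linear P x -> P x}))
    (fun x y h v => erefl).
move=> M N p f ps; have [g gE] := @free_on_proj k E T _ M N p (nt_comp f j) ps.
exists (nt_comp g i); apply: nat_trans_ext => x u.
exact: (congr1 (fun t : nat_trans P N => t x u) gE).
Qed.

Lemma restrict_inj V W (B : set D) (f g : nat_trans V W) :
  generated_in_set V B -> B `<=` A -> restrict_nt f = restrict_nt g -> f = g.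
Proof.
move=> gV BA fg; apply: (generated_eq gV) => -[x Bx] v.
pose x' : E := exist _ x (BA x Bx).
exact: (congr1 (fun t : nat_trans (restrict_rep A V) (restrict_rep A W) =>
                  t x' v) fg).
Qed.

(** Present [V] by the free cover [p] on all its vectors in degrees [B].  The
    components of [f] in these degrees define a map [phi] out of the cover; it
    agrees with [f \o p] on [A], hence it kills the kernel of [p] in the degrees
    [mu(B)], which generate this kernel, and so it descends to [V]. *)
Lemma restrict_full (mu : D -> set D) V W (B : set D) :
  homological_modulus k mu -> generated_in_set V B -> B `<=` A ->
  \bigcup_(x in B) mu x `<=` A ->
  forall f : nat_trans (restrict_rep A V) (restrict_rep A W),
  exists g : nat_trans V W, restrict_nt g = f.
Proof.
move=> hmu gV BA muA f.
pose T := {y : {y | B y} & V (sval y)}.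
pose deg (t : T) := sval (tag t).
pose emb (t : T) : E := exist _ (deg t) (BA _ (svalP (tag t))).
pose p : nat_trans (free_on k deg) V :=
  free_map (fun t : T => tagged t : V (deg t)).
pose phi : nat_trans (free_on k deg) W :=
  free_map (fun t : T => f (emb t) (tagged t) : W (deg t)).
have ps : surj_nt p := generated_cover gV.
pose P' := restrict_rep A (free_on k deg).
have phiE : restrict_nt phi = nt_comp f (restrict_nt p).
  apply: nat_trans_ext => x.
  apply: (free_on_linear_eq (f := phi (sval x)) (g := f x \o p (sval x))) => t h.
  transitivity (f x (rep_map V h (tagged t))).
    rewrite [LHS]free_mapE.
    exact: (esym (@nt_nat _ _ _ _ f (emb t) x h (tagged t))).
  by have <- : p (sval x) (free_elt t h) = _ := free_mapE _ h.
have [g gE] : exists g : nat_trans V W, nt_comp g p = phi.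
  apply: nt_descend => // x u pu.
  have uk : u \in ker_pred (p x) by rewrite inE pu.
  pose z := nt_comp phi (ker_incl p).
  have -> : phi x u = z x (Kermod uk) by [].
  have -> : z = nt_zero (ker_rep p) W; last by [].
  apply: (generated_eq (ker_generated hmu (f := p))) => -[y By] v.
  have Ay : A y.
    apply: muA; have [_ [t _ <-] my] := By.
    by exists (deg t) => //; exact: svalP (tag t).
  pose y' : E := exist _ y Ay.
  have := congr1 (fun t : nat_trans P' (restrict_rep A W) => t y' (val v)) phiE.
  by move=> /= ->; rewrite [fm_lift _ _]kermodP linear0.
exists g; apply: nat_trans_ext => x v.
have [u <-] := ps (sval x) v.
have := congr1 (fun t : nat_trans P' (restrict_rep A W) => t x u) phiE.
by rewrite -gE.
Qed.

End Restriction.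

(** * Syzygies up to homotopy *)

Section Stages.
Variables (k : comPzRingType) (D : category).
Implicit Types U V W : rep k D.

(** The inclusion of a syzygy [st_ker] in the projective [st_amb] that
    precedes it in a resolution. *)
Record stage := Stage {
  st_ker : rep k D;
  st_amb : rep k D;
  st_incl : nat_trans st_ker st_amb }.

Implicit Types S T : stage.

Definition nt_id V : nat_trans V V :=
  @NatTrans k D V V (fun x => idfun) (fun x y h v => erefl).

Definition st_map S S' (a : nat_trans (st_ker S) (st_ker S'))
    (a' : nat_trans (st_amb S) (st_amb S')) : Prop :=
  nt_comp (st_incl S') a = nt_comp a' (st_incl S).

(** The [st_ker] part of a homotopy to the identity, when a stage is regarded
    as a two-term complex. *)
Definition st_homotopic S (c : nat_trans (st_ker S) (st_ker S)) : Prop :=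
  exists h : nat_trans (st_amb S) (st_ker S),
    c = nt_id (st_ker S) + nt_comp h (st_incl S).

Lemma st_homotopic_id S (c : nat_trans (st_ker S) (st_ker S)) :
  (forall x v, c x v = v) -> @st_homotopic S c.
Proof.
move=> cE; exists 0; apply: nat_trans_ext => x v.
by rewrite cE; exact: (esym (addr0 v)).
Qed.

Definition st_equiv S S' : Prop :=
  exists a a' b b', [/\ @st_map S S' a a', @st_map S' S b b',
    st_homotopic (nt_comp b a) & st_homotopic (nt_comp a b)].

Lemma st_equiv_refl S : st_equiv S S.
Proof.
exists (nt_id _), (nt_id _), (nt_id _), (nt_id _).
by split; try exact: nat_trans_ext; exact: st_homotopic_id.
Qed.

(** The exactness of [st_ker T -> st_amb T -> st_ker S] and of its ends, with
    a projective middle term: [T] is the stage following [S]. *)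
Definition st_step S T (p : nat_trans (st_amb T) (st_ker S)) : Prop :=
  [/\ projective (st_amb T), surj_nt p,
      (forall x, injective (st_incl T x)) &
      forall x v, p x v = 0 <-> exists u, st_incl T x u = v].

Lemma step_lift S S' T T' p p' (a : nat_trans (st_ker S) (st_ker S')) :
  @st_step S T p -> @st_step S' T' p' ->
  exists b b', @st_map T T' b b' /\ nt_comp p' b' = nt_comp a p.
Proof.
move=> [Pp _ _ pk] [_ ps' ii' pk'].
have [b' b'E] := Pp _ _ p' (nt_comp a p) ps'.
have [x v|b bE] :=
    nt_factor_mono (i := st_incl T') (f := nt_comp b' (st_incl T)) ii'.
  apply/pk'; rewrite nt_compE -nt_compE b'E nt_compE.
  have -> : p x (st_incl T x v) = 0 by apply/pk; exists v.
  by rewrite linear0.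
by exists b, b'.
Qed.

(** If [b \o a] differs from the identity by [h \o st_incl S], lift [h] through
    [p] to [l].  The map [d' \o c' - 1 - l \o st_incl S \o p] has zero composite
    with [p], so it takes its values in [st_ker T]; this is the new homotopy. *)
Lemma step_homotopic S S' T T' p p'
    (a : nat_trans (st_ker S) (st_ker S')) (b : nat_trans (st_ker S') (st_ker S))
    (c : nat_trans (st_ker T) (st_ker T')) c' d d' :
  projective (st_amb S) -> @st_step S T p -> @st_step S' T' p' ->
  st_homotopic (nt_comp b a) ->
  @st_map T T' c c' -> nt_comp p' c' = nt_comp a p ->
  @st_map T' T d d' -> nt_comp p d' = nt_comp b p' ->
  st_homotopic (nt_comp d c).
Proof.
move=> PS [Pp ps ii pk] _ [h hE] cE c'E dE d'E.
have pE f g : @nt_comp k D (st_ker T) _ _ f (st_incl T) = g ->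
    forall x v, f x (st_incl T x v) = g x v by move=> <-.
(* Lift the given homotopy [h]; [r] corrects the composite of the lifts. *)
have [l lE] := PS _ _ p h ps.
pose r := nt_comp d' c' - nt_id _ - nt_comp (nt_comp l (st_incl S)) p.
have rE x v : r x v = d' x (c' x v) - v - l x (st_incl S x (p x v)) by [].
have pl x v : p x (l x v) = h x v by rewrite -lE.
have pd x v : p x (d' x v) = b x (p' x v) by rewrite -[LHS]nt_compE d'E.
have pc x v : p' x (c' x v) = a x (p x v) by rewrite -[LHS]nt_compE c'E.
have dI x v : d' x (st_incl T' x v) = st_incl T x (d x v).
  by rewrite -[LHS]nt_compE -dE.
have cI x v : c' x (st_incl T x v) = st_incl T' x (c x v).
  by rewrite -[LHS]nt_compE -cE.
have ba x v : b x (a x v) = v + h x (st_incl S x v).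
  by rewrite -[LHS]nt_compE hE.
have [x v|m mE] := nt_factor_mono (i := st_incl T) (f := r) ii.
  apply/pk; rewrite rE !linearB /= pd pc ba pl.
  by rewrite addrAC addrK subrr.
exists m; apply: nat_trans_ext => x v; apply: ii.
have -> : (nt_id (st_ker T) + nt_comp m (st_incl T)) x v =
    v + m x (st_incl T x v) by [].
have mx u : st_incl T x (m x u) = r x u by rewrite -mE.
have p0 : p x (st_incl T x v) = 0 by apply/pk; exists v.
by rewrite linearD mx rE p0 !linear0 addr0 cI dI addrC subrK.
Qed.

(** One step of Schanuel's lemma.  The ambient representations of [S] and
    [S'] are projective in order that homotopies can be lifted. *)
Lemma step_equiv S S' T T' p p' :
  projective (st_amb S) -> projective (st_amb S') ->
  @st_step S T p -> @st_step S' T' p' -> st_equiv S S' -> st_equiv T T'.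
Proof.
move=> PS PS' sT sT' [a [_ [b [_ [_ _ ba ab]]]]].
have [c [c' [cE c'E]]] := step_lift a sT sT'.
have [d [d' [dE d'E]]] := step_lift b sT' sT.
exists c, c', d, d'; split=> //.
  exact: (step_homotopic PS sT sT' ba cE c'E dE d'E).
exact: (step_homotopic PS' sT' sT ab dE d'E cE c'E).
Qed.

Definition extends S W (g : nat_trans (st_ker S) W) : Prop :=
  exists g', nt_comp g' (st_incl S) = g.

(** A homotopy equivalence pulls back extensions to extensions, and the
    homotopies make it bijective modulo extensions. *)
Lemma equiv_quot S S' W Q :
  st_equiv S S' -> quot_by (@extends S' W) Q -> quot_by (@extends S W) Q.
Proof.
move=> [a [a' [b [b' [aE bE [h hE] [h' h'E]]]]]].
have compA U1 U2 U3 U4 (f : nat_trans U3 U4) (g : nat_trans U2 U3)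
    (l : nat_trans U1 U2) : nt_comp (nt_comp f g) l = nt_comp f (nt_comp g l).
  exact: nat_trans_ext.
have compD U1 U2 U3 (f : nat_trans U2 U3) (g l : nat_trans U1 U2) :
    nt_comp f (g + l) = nt_comp f g + nt_comp f l.
  by apply: nat_trans_ext => x v; rewrite nt_compE linearD.
have comp1 U1 U2 (f : nat_trans U1 U2) : nt_comp f (nt_id U1) = f.
  exact: nat_trans_ext.
apply: (quot_by_transfer (f := @precomp k D _ _ W b)) => [g|g'].
  split=> [[e <-]|[e eE]].
    by exists (nt_comp e b'); rewrite compA -bE -compA.
  exists (nt_comp e a' - nt_comp g h).
  have -> : nt_comp (nt_comp e a' - nt_comp g h) (st_incl S) =
      nt_comp (nt_comp e a') (st_incl S) - nt_comp (nt_comp g h) (st_incl S).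
    exact: nat_trans_ext.
  rewrite !compA -aE -[nt_comp e _]compA eE /precomp compA hE compD comp1.
  by rewrite addrK.
exists (nt_comp g' a); exists (- nt_comp g' h').
rewrite -[RHS]/(g' - nt_comp (nt_comp g' a) b) [nt_comp _ b]compA h'E.
rewrite compD comp1 opprD addrA subrr add0r.
exact: nat_trans_ext.
Qed.

(** The zero representation, presented as the free one on no generators so
    that the facts on free representations apply to it. *)
Definition zero_rep : rep k D := free_on k (False_rect D).

Definition ext_amb V n : rep k D :=
  if n is m.+1 then free_cover (syzygy V m) else zero_rep.

(** In degree 0 the ambient representation is zero, so that extending along
    the inclusion means vanishing: this matches the zero map entering the complex
    that defines [Ext]. *)
Definition ext_incl V n : nat_trans (syzygy V n) (ext_amb V n) :=
  match n with
  | 0 => nt_zero V zero_rep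
  | m.+1 => ker_incl (cover_aug (syzygy V m))
  end.

Definition ext_stage V n : stage := Stage (ext_incl V n).

Lemma ext_stage_proj V n : projective (st_amb (ext_stage V n)).
Proof. by case: n => [|n]; [exact: free_on_proj|exact: free_cover_proj]. Qed.

Lemma ker_step S P (p : nat_trans P (st_ker S)) :
  projective P -> surj_nt p -> @st_step S (Stage (ker_incl p)) p.
Proof.
move=> PP ps; split=> //= [x u v /val_inj //|x v].
split=> [pv|[u <-]]; last exact: kermodP.
have vk : v \in ker_pred (p x) by rewrite inE pv.
by exists (Kermod vk).
Qed.

Lemma ext_step V n :
  @st_step (ext_stage V n) (ext_stage V n.+1) (cover_aug (syzygy V n)).
Proof.
apply: (@ker_step (ext_stage V n)); first exact: free_cover_proj.
exact: cover_aug_surj.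
Qed.

(** A cocycle on the [q]-th free cover vanishes on the kernel of its
    augmentation, that is, it comes from a map out of the [q]-th syzygy; and it is
    a coboundary when that map extends to the preceding cover. *)
Lemma Ext_quot V q W : quot_by (@extends (ext_stage V q) W) (Ext q V W).
Proof.
pose aug := cover_aug (syzygy V q).
have augI : injective (@precomp k D _ _ W aug).
  move=> g g' gg'; apply: nat_trans_ext => x v.
  have [u <-] := @cover_aug_surj _ _ _ x v.
  exact: (congr1 (fun t : nat_trans (free_cover _) W => t x u) gg').
have augK (m : nat_trans (free_cover (syzygy V q)) W) :
    @precomp k D _ _ W (free_res_d V q) m = 0 <-> exists a, precomp aug a = m.
  split=> [m0|[a <-]]; last first.
    apply: nat_trans_ext => x v; rewrite /precomp !nt_compE.
    have -> : aug x (free_res_d V q x v) = 0 by apply/free_res_exact; exists v.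
    by rewrite linear0.
  apply: nt_descend; first exact: cover_aug_surj.
  move=> x u /free_res_exact[v <-].
  exact: (congr1 (fun t : nat_trans (free_cover _) W => t x v) m0).
case: q => [|q] in aug augI augK *.
  have := quot_by_homology (\0 : {linear nat_trans (free_cover V) W -> _})
    augI augK.
  apply: quot_by_ext => g; split=> [[l /esym e]|[e <-]].
    by exists 0; apply: augI; rewrite e; exact: nat_trans_ext.
  exists 0; apply: nat_trans_ext => x v.
  exact: (esym (linear0 (e x))).
have := quot_by_homology (@precomp k D _ _ W (free_res_d V q)) augI augK.
apply: quot_by_ext => g; split=> [[e eE]|[e <-]]; exists e; last first.
  exact: nat_trans_ext.
by apply: augI; rewrite -[RHS]eE; exact: nat_trans_ext.
Qed.

End Stages.

(** * Comparing Ext on the category and on the subcategory *)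

Section RestrictStage.
Variables (k : comPzRingType) (D : category) (A : set D).

Definition restrict_stage (S : stage k D) : stage k (full_subcat A) :=
  Stage (restrict_nt A (st_incl S)).

Lemma restrict_step (S T : stage k D) p :
  @st_step k D S T p -> projective (restrict_rep A (st_amb T)) ->
  @st_step k _ (restrict_stage S) (restrict_stage T) (restrict_nt A p).
Proof.
move=> [_ ps ii pk] PT; split=> //.
- by move=> x; exact: ps.
- by move=> x; exact: ii.
by move=> x; exact: pk.
Qed.

(** Both [st_ker S] and [st_amb S] have the same maps to [W] on the category
    and on the subcategory. *)
Lemma restrict_quot (mu : D -> set D) (S : stage k D) (W : rep k D)
    (B C : set D) Q :
  homological_modulus k mu ->
  generated_in_set (st_ker S) B -> B `<=` A -> \bigcup_(x in B) mu x `<=` A ->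
  generated_in_set (st_amb S) C -> C `<=` A -> \bigcup_(x in C) mu x `<=` A ->
  quot_by (@extends _ _ (restrict_stage S) (restrict_rep A W)) Q ->
  quot_by (@extends _ _ S W) Q.
Proof.
move=> hmu gK BA mB gI CA mC.
apply: (quot_by_transfer (f := @restrict_nt k D A (st_ker S) W)) => [g|g'].
  split=> [[e <-]|[e' e'E]].
    by exists (restrict_nt A e); exact: nat_trans_ext.
  have [e eE] := restrict_full hmu gI CA mC e'.
  exists e; apply: (restrict_inj gK BA).
  by rewrite -[RHS]e'E -eE; exact: nat_trans_ext.
have [g gE] := restrict_full hmu gK BA mB g'.
exists g; exists 0; rewrite -[GRing.Linear.sort _ _]/(restrict_nt A g) gE subrr.
exact: nat_trans_ext.
Qed.

End RestrictStage.

Section Compare.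
Variables (k : comPzRingType) (D : category) (mu : D -> set D).
Hypothesis hmu : homological_modulus k mu.
Variables (V : rep k D) (B : set D).
Hypothesis gV : generated_in_set V B.

Let M n := modulus_iter mu n B.

(** The resolution of [V] by free representations in degrees [mu^p(B)],
    followed up to stage [n] and compared with the canonical resolutions on both
    sides.  Only the degrees up to [n - 1] have to lie in [A], because stage [n]
    involves no generators of the free cover of its own syzygy. *)
Lemma modulus_stage (A : set D) n : (forall p, (p < n)%N -> M p `<=` A) ->
  exists S : stage k D,
    [/\ projective (st_amb S) /\ projective (restrict_rep A (st_amb S)),
        st_equiv (ext_stage V n) S,
        st_equiv (restrict_stage A S) (ext_stage (restrict_rep A V) n),
        generated_in_set (st_ker S) (M n) &
        generated_in_set (st_amb S) (if n is m.+1 then M m else set0)].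
Proof.
elim: n => [|n IH] MA.
  have PR : projective (restrict_rep A (zero_rep k D)).
    by exact: restrict_free_proj.
  exists (ext_stage V 0); split=> //.
  - by split=> //; exact: free_on_proj.
  - exact: st_equiv_refl.
  - pose V' := restrict_rep A V.
    exists (nt_id V'), 0, (nt_id V'), 0.
    by split; try exact: nat_trans_ext; exact: st_homotopic_id.
  - exact: free_on_generated.
have [|S [[PS PRS] eS eRS gK gI]] := IH.
  by move=> p pn; apply: MA; exact: ltnW.
have MnA : M n `<=` A by exact: MA.
pose T := {y : {y | M n y} & st_ker S (sval y)}.
pose deg (t : T) := sval (tag t).
have ps := generated_cover gK.
set p := free_map _ in ps.
have PF : projective (free_on k deg) by exact: free_on_proj.
have PRF : projective (restrict_rep A (free_on k deg)).
  by apply: restrict_free_proj => t; apply: MnA; exact: svalP (tag t).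
have sT := ker_step PF ps.
exists (Stage (ker_incl p)); split=> //.
- exact: (step_equiv (@ext_stage_proj k D V n) PS (@ext_step k D V n) sT eS).
- exact: (step_equiv (S := restrict_stage A S) PRS (@ext_stage_proj k _ _ n)
           (restrict_step sT PRF) (@ext_step k _ _ n) eRS).
- apply: generated_sub (ker_generated hmu (f := p)) => y [_ [t _ <-] my].
  by exists (deg t) => //; exact: svalP (tag t).
- by apply: free_on_generated => t; exact: svalP (tag t).
Qed.

End Compare.

Lemma Ext_restrict (k : comPzRingType) (D : category) (mu : D -> set D)
    (V W : rep k D) (B A : set D) q :
  homological_modulus k mu -> generated_in_set V B ->
  (forall p, (p <= q.+1)%N -> modulus_iter mu p B `<=` A) ->
  lmod_iso (Ext q V W) (Ext q (restrict_rep A V) (restrict_rep A W)).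
Proof.
move=> hmu gV MA.
have [|S [_ eS eRS gK gI]] := modulus_stage hmu gV (A := A) (n := q).
  by move=> p pq; apply: MA; rewrite ltnW // ltnS ltnW.
apply: quot_by_unique (Ext_quot V q W) (equiv_quot eS _).
apply: (restrict_quot hmu gK _ _ gI).
- by apply: MA; exact: leqnSn.
- exact: (MA q.+1).
- case: q {eS eRS gK gI} MA => [|q] MA; first by move=> x [].
  by apply: MA; rewrite ltnW.
- case: q {eS eRS gK gI} MA => [|q] MA; first by move=> x [? []].
  by apply: (MA q.+1); exact: leqnSn.
exact: equiv_quot eRS (Ext_quot _ _ _).
Qed.

(** * Finitely generated modules over a noetherian ring *)

Section Span.
Variable k : comPzRingType.

Section SpanModule.
Variable M : lmodType k.
Implicit Types (s : seq M) (u v : M).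

(** Coefficients are introduced one generator at a time, which suits
    inductions on the list. *)
Fixpoint lin_span s v : Prop :=
  if s is b :: s' then exists a : k, lin_span s' (v - a *: b) else v = 0.

Definition submod (S : M -> Prop) :=
  S 0 /\ forall a u v, S u -> S v -> S (a *: u + v).

Lemma lin_span_submod s : submod (lin_span s).
Proof.
split; elim: s => [|b s IH] //=; first by exists 0; rewrite scale0r subr0.
- by move=> a u v -> ->; rewrite scaler0 addr0.
- move=> a u v [c uc] [d vd]; exists (a * c + d).
  have -> : a *: u + v - (a * c + d) *: b = a *: (u - c *: b) + (v - d *: b).
    by rewrite scalerDl scalerBr scalerA opprD addrACA.
  exact: IH.
Qed.

Lemma submod_sum (S : M -> Prop) (I : Type) (r : seq I) (c : I -> k)
    (F : I -> M) :
  submod S -> (forall i, S (F i)) -> S (\sum_(i <- r) c i *: F i).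
Proof.
move=> [S0 SP] SF; elim: r => [|i r IH]; first by rewrite big_nil.
by rewrite big_cons; exact: SP.
Qed.

Lemma submodB (S : M -> Prop) u v : submod S -> S u -> S v -> S (v - u).
Proof. by move=> [_ SP] Su Sv; rewrite addrC -scaleN1r; exact: SP. Qed.

Lemma lin_span_sub (S : M -> Prop) s v :
  submod S -> (forall b, b \in s -> S b) -> lin_span s v -> S v.
Proof.
move=> sS; elim: s v => [|b s IH] v Ss /=; first by move=> ->; case: sS.
move=> [a /IH Sv]; rewrite -(subrK (a *: b) v) addrC; apply: sS.2.
  by apply: Ss; rewrite mem_head.
by apply: Sv => c cs; apply: Ss; rewrite in_cons cs orbT.
Qed.

Lemma mem_lin_span s b : b \in s -> lin_span s b.
Proof.
elim: s => //= c s IH; rewrite in_cons => /predU1P[->|/IH bs].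
  by exists 1; rewrite scale1r subrr; case: (lin_span_submod s).
by exists 0; rewrite scale0r subr0.
Qed.

Lemma lin_span_cat s t u v :
  lin_span s u -> lin_span t v -> lin_span (s ++ t) (u + v).
Proof.
move=> su tv; rewrite -[u]scale1r; apply: (lin_span_submod _).2.
  by apply: lin_span_sub su => [|b bs]; [exact: lin_span_submod|
     apply: mem_lin_span; rewrite mem_cat bs].
by apply: lin_span_sub tv => [|b bt]; [exact: lin_span_submod|
   apply: mem_lin_span; rewrite mem_cat bt orbT].
Qed.

Lemma fg_lin_span : fg_mod M <-> exists s, forall v, lin_span s v.
Proof.
split=> [[n [b bP]]|[s sP]].
  exists [seq b i | i <- enum 'I_n] => v; have [c ->] := bP v.
  apply: (submod_sum _ _ (lin_span_submod _)) => i; apply: mem_lin_span.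
  by apply: map_f; rewrite mem_enum.
exists (size s), (fun i => s`_i) => v.
have [c ->] : exists c : nat -> k, v = \sum_(i < size s) c i *: s`_i.
  elim: s v {sP}(sP v) => [|b s IH] v /=.
    by exists (fun=> 0); rewrite big_ord0.
  move=> [a /IH[c cE]]; exists (fun i => if i is j.+1 then c j else a).
  by rewrite big_ord_recl /= -cE addrC subrK.
by exists (fun i => c i).
Qed.

(** The leading coefficients along [b] of the elements of [S] form an ideal;
    lift generators of this ideal to [S] and apply the induction hypothesis to the
    elements of [S] spanned by the other generators. *)
Lemma noetherian_lin_span s (S : M -> Prop) : noetherian k ->
  submod S -> (forall v, S v -> lin_span s v) ->
  exists s', (forall b, b \in s' -> S b) /\ forall v, S v -> lin_span s' v.
Proof.
move=> noeth; elim: s S => [|b s IH] S sS Ss; first by exists [::]; split.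
pose J : {pred k^o} := fun a => `[< exists v, S v /\ lin_span s (v - a *: b) >].
have [s0 sP] := lin_span_submod s.
have JC : GRing.submod_closed J.
  split=> [|a u v /asboolP[u' [Su su]] /asboolP[v' [Sv sv]]]; apply/asboolP.
    by exists 0; split; [case: sS|rewrite scale0r subr0].
  exists (a *: u' + v'); split; first exact: sS.2.
  have -> : a *: u' + v' - (a *: u + v) *: b =
      a *: (u' - u *: b) + (v' - v *: b).
    by rewrite scalerDl scalerBr -[(a *: u) *: b]scalerA opprD addrACA.
  exact: sP.
have [n [g [gJ gP]]] := noeth J JC.
have /choice[w wP] : forall i, exists v, S v /\ lin_span s (v - g i *: b).
  by move=> i; exact/asboolP/gJ.
have sS' : submod (fun v => S v /\ lin_span s v).
  split=> [|a u v [Su su] [Sv sv]]; first by split=> //; case: sS.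
  by split; [exact: sS.2|exact: sP].
have [|s' [s'S s'P]] := IH _ sS'; first by move=> v [].
exists ([seq w i | i <- enum 'I_n] ++ s'); split=> [v|v Sv].
  rewrite mem_cat => /orP[/mapP[i _ ->]|/s'S[] //]; exact: (wP i).1.
have [a av] := Ss v Sv.
have /gP[c cE] : a \in J by apply/asboolP; exists v.
pose u := \sum_(i < n) c i *: w i.
rewrite -(subrK u v) addrC; apply: lin_span_cat.
  apply: (submod_sum _ _ (lin_span_submod _)) => i; apply: mem_lin_span.
  by apply: map_f; rewrite mem_enum.
apply: s'P; split.
  by apply: submodB => //; apply: submod_sum => // i; exact: (wP i).1.
have -> : v - u = v - a *: b - \sum_(i < n) c i *: (w i - g i *: b).
  under eq_bigr do rewrite scalerBr scalerA.
  by rewrite sumrB -scaler_suml -cE opprB addrA subrK.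
apply: (submodB (S := lin_span s)) => //.
by apply: submod_sum => // i; exact: (wP i).2.
Qed.

End SpanModule.

Lemma lin_span_lift (M N : lmodType k) (f : {linear M -> N}) (S : M -> Prop) s1 :
  (forall w, w \in s1 -> exists v, S v /\ f v = w) ->
  exists s, (forall b, b \in s -> S b) /\
    forall w, lin_span s1 w -> exists u, lin_span s u /\ f u = w.
Proof.
elim: s1 => [|b s1 IH] Ss.
  by exists [::]; split=> // w ->; exists 0; rewrite linear0.
have [b' [Sb' <-]] := Ss b (mem_head _ _).
have [w ws1|s [sS sP]] := IH; first by apply: Ss; rewrite in_cons ws1 orbT.
exists (b' :: s); split=> [c|w /= [a /sP[u [su fu]]]].
  by rewrite in_cons => /predU1P[->|/sS].
exists (u + a *: b'); split; first by exists a; rewrite addrK.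
by rewrite linearD linearZ fu subrK.
Qed.

(** This replaces the embedding in the product of the [N t], which would have
    dependent factors: the maps [f t] are treated one at a time, passing to the
    kernel of the preceding ones. *)
Lemma noetherian_joint (M : lmodType k) (T : Type) (N : T -> lmodType k)
    (f : forall t, {linear M -> N t}) (L : seq T) (S : M -> Prop) :
  noetherian k -> (forall t, List.In t L -> fg_mod (N t)) -> submod S ->
  exists s', (forall b, b \in s' -> S b) /\
    forall v, S v -> exists u, lin_span s' u /\
      forall t, List.In t L -> f t (v - u) = 0.
Proof.
move=> noeth; elim: L S => [|t L IH] S NL sS.
  by exists [::]; split=> // v Sv; exists 0.
have imS : submod (fun w => exists v, S v /\ f t v = w).
  split=> [|a u v [u' [Su <-]] [v' [Sv <-]]].
    by exists 0; rewrite linear0; split=> //; case: sS.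
  by exists (a *: u' + v'); rewrite linearP; split=> //; exact: sS.2.
have /fg_lin_span[sN sNP] : fg_mod (N t) by apply: NL; left.
have [|s1 [s1S s1P]] := noetherian_lin_span (s := sN) noeth imS.
  by move=> w _; exact: sNP.
have [r1 [r1S r1P]] := lin_span_lift s1S.
have sS2 : submod (fun v => S v /\ f t v = 0).
  split=> [|a u v [Su fu] [Sv fv]]; first by rewrite linear0; case: sS.
  by rewrite linearP fu fv scaler0 addr0; split=> //; exact: sS.2.
have [|r2 [r2S r2P]] := IH _ _ sS2; first by move=> t' t'L; apply: NL; right.
exists (r1 ++ r2); split=> [b|v Sv].
  by rewrite mem_cat => /orP[/r1S//|/r2S[]].
have [u1 [ru1 fu1]] : exists u, lin_span r1 u /\ f t u = f t v.
  by apply/r1P/s1P; exists v.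
have Su1 : S u1 by exact: lin_span_sub sS r1S ru1.
have [|u2 [ru2 fu2]] := r2P (v - u1).
  by split; [exact: submodB|rewrite linearB fu1 subrr].
have [_ fu20] : S u2 /\ f t u2 = 0 by exact: lin_span_sub sS2 r2S ru2.
exists (u1 + u2); split; first exact: lin_span_cat.
move=> t' [<-|/fu2 <-]; last by rewrite opprD addrA.
by rewrite linearB linearD fu1 fu20 addr0 subrr.
Qed.

Lemma noetherian_embed (M : lmodType k) (T : Type) (N : T -> lmodType k)
    (f : forall t, {linear M -> N t}) (L : seq T) :
  noetherian k -> (forall t, List.In t L -> fg_mod (N t)) ->
  (forall v, (forall t, List.In t L -> f t v = 0) -> v = 0) -> fg_mod M.
Proof.
move=> noeth NL finj.
have [|s [_ sP]] := noetherian_joint f (S := fun => True) noeth NL.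
  by split.
apply/fg_lin_span; exists s => v; have [//|u [su /finj/eqP]] := sP v.
by rewrite subr_eq0 => /eqP->.
Qed.

Lemma fg_quot (A Q : lmodType k) (B : A -> Prop) :
  quot_by B Q -> fg_mod A -> fg_mod Q.
Proof.
move=> [p [ps _]] [n [b bP]]; exists n, (p \o b) => z.
have [a <-] := ps z; have [c ->] := bP a; exists c.
by rewrite linear_sum; apply: eq_bigr => i _; rewrite linearZ_LR.
Qed.

End Span.

(** * Finite types *)

Definition finite_type (T : Type) := exists s : seq T, forall t, List.In t s.

Lemma in_List (T : eqType) (x : T) (s : seq T) : x \in s -> List.In x s.
Proof.
elim: s => //= y s IH; rewrite in_cons => /predU1P[->|/IH xs]; first by left.
by right.
Qed.

Lemma finite_type_fin (T : finType) : finite_type T.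
Proof. by exists (enum T) => t; apply: in_List; rewrite mem_enum. Qed.

Lemma finite_type_sigma (T : Type) (B : T -> Type) :
  finite_type T -> (forall t, finite_type (B t)) -> finite_type {t : T & B t}.
Proof.
move=> [s sT] fB.
have [l lP] : exists l : seq {t : T & B t},
    forall t (b : B t), List.In t s -> List.In (existT B t b) l.
  elim: s {sT} => [|t s [l lP]]; first by exists [::].
  have [r rP] := fB t; exists (map (existT B t) r ++ l) => t' b [tt'|t's].
    subst t'; apply/List.in_app_iff; left; exact: List.in_map.
  by apply/List.in_app_iff; right; exact: lP.
by exists l => -[t b]; exact: lP.
Qed.

Lemma finite_set_type (T : Type) (B : set T) :
  finite_set B -> finite_type {x | B x}.
Proof.
move=> /(@finite_seqP {classic T})[s sB].
have [l lP] : exists l : seq {x | B x},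
    forall x (Bx : B x), List.In (x : {classic T}) s -> List.In (exist _ x Bx) l.
  elim: s {sB} => [|y s [l lP]]; first by exists [::].
  have [By|nBy] := pselect (B y).
    exists (exist _ y By :: l) => x Bx [yx|xs]; last by right; exact: lP.
    by left; subst y; congr exist; exact: Prop_irrelevance.
  by exists l => x Bx [yx|]; [subst y|exact: lP].
exists l => -[x Bx]; apply: lP; apply: in_List.
have : [set` s] (x : {classic T}) by rewrite -sB.
by [].
Qed.

Lemma finite_setT_type (T : Type) : finite_set [set: T] -> finite_type T.
Proof.
move=> /finite_set_type[s sP]; exists (map sval s) => t.
exact: (List.in_map sval _ _ (sP (exist _ t I))).
Qed.

Lemma freemod_fg (k : comPzRingType) (T : Type) :
  finite_type T -> fg_mod (freemod k T).
Proof.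
move=> [s sT]; apply/fg_lin_span; exists (map (@fm_gen k T) s) => u.
have genP t : lin_span (map (@fm_gen k T) s) (fm_gen k t).
  apply: mem_lin_span; have := sT t.
  elim: (s) => //= t' r IH; rewrite in_cons => -[->|/IH ->].
    by rewrite eqxx.
  exact: orbT.
by have <- := freemod_sum u; apply: submod_sum => //; exact: lin_span_submod.
Qed.

(** * Finitely generated representations *)

Section FiniteGeneration.
Variables (k : comPzRingType) (D : category).
Implicit Types (V K P : rep k D) (B : set D).

Definition fin_gen V B :=
  exists (T : Type) (deg : T -> D) (v : forall t, V (deg t)),
  [/\ finite_type T, forall t, B (deg t) & surj_nt (free_map v)].

(** Finitely many degrees and finitely many vectors in each of them. *)
Lemma fin_gen_pointwise V B (Z : Type) (e : Z -> D) :
  finite_type Z -> (forall z, B (e z)) -> generated_in V e ->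
  (forall z, fg_mod (V (e z))) -> fin_gen V B.
Proof.
move=> fZ Be gV fV.
have [b bP] : {b : forall z, {n & 'I_n -> V (e z)} & forall z v,
    exists c : 'I_(tag (b z)) -> k, v = \sum_i c i *: tagged (b z) i}.
  have bP z : exists nb : {n & 'I_n -> V (e z)}, forall v,
      exists c : 'I_(tag nb) -> k, v = \sum_i c i *: tagged nb i.
    by have [n [b bP]] := fV z; exists (existT _ n b).
  by exists (fun z => sval (cid (bP z))) => z; exact: svalP (cid (bP z)).
pose T := {z : Z & 'I_(tag (b z))}.
pose deg (t : T) := e (tag t).
exists T, deg, (fun t => tagged (b (tag t)) (tagged t) : V (deg t)).
split=> [|t|].
- by apply: finite_type_sigma => // z; exact: finite_type_fin.
- exact: Be.
apply: (generated_surj gV) => z v; have [c ->] := bP z v.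
pose el i : free_on k deg (e z) := free_elt (existT _ z i : T) (id_mor (e z)).
exists (\sum_i c i *: el i).
rewrite linear_sum; apply: eq_bigr => i _; rewrite linearZ_LR.
by rewrite [free_map _ _ _]free_mapE rep_map1.
Qed.

(** The generators [v] lift through [f], hence so does the free cover on them. *)
Lemma surj_lift_gens V P (T : Type) (deg : T -> D) (v : forall t, V (deg t))
    (f : nat_trans P V) :
  surj_nt (free_map v) -> (forall t, exists u, f (deg t) u = v t) -> surj_nt f.
Proof.
move=> vs fv.
pose u t := sval (cid (fv t)).
have uE t : f _ (u t) = v t by exact: svalP (cid (fv t)).
have fu : nt_comp f (free_map u) = free_map v.
  by apply: free_nt_eq => t; rewrite nt_compE !free_mapE !rep_map1.
move=> x w; have [z <-] := vs x w.
by exists (free_map u x z); rewrite -fu.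
Qed.

(** The degrees [d] may be infinite in number and unrelated to the degrees in
    which finite generation is given, but each of the finitely many generators is
    a finite combination of vectors pushed forward from degrees [d i]; these
    vectors form a finite generating family. *)
Lemma fin_gen_range V (I : Type) (d : I -> D) :
  fg_rep V -> generated_in V d -> fin_gen V (range d).
Proof.
move=> [l [e [gV fV]]] dV.
have [T [deg [v [fT _ vs]]]] : fin_gen V setT.
  by apply: fin_gen_pointwise gV fV => //; exact: finite_type_fin.
pose T' := {i : I & V (d i)}.
pose deg' (t : T') := d (tag t).
pose v' (t : T') : V (deg' t) := tagged t.
have v's : surj_nt (free_map v') := generated_cover dV.
pose u t : free_on k deg' (deg t) := sval (cid (v's _ (v t))).
have uE t : free_map v' (deg t) (u t) = v t by exact: svalP (cid (v's _ (v t))).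
pose T1 := {t : T & 'I_(size (fm_repr (u t)))}.
(* [term (t, i)] is the [i]-th scalar and basis element of the lift of [v t]. *)
pose term (t : T1) := tnth (in_tuple (fm_repr (u (tag t)))) (tagged t).
pose deg1 (t : T1) := deg' (tag (term t).2).
pose v1 (t : T1) : V (deg1 t) := v' (tag (term t).2).
exists T1, deg1, v1; split=> [|t|].
- by apply: finite_type_sigma => // t; exact: finite_type_fin.
- by exists (tag (tag (term t).2)).
apply: (surj_lift_gens vs) => t.
pose el i : T1 := existT _ t i.
pose elt i : free_on k deg1 (deg t) := free_elt (el i) (tagged (term (el i)).2).
exists (\sum_i (term (el i)).1 *: elt i).
rewrite -uE -[u t in RHS]freemod_sum [in RHS]big_tnth !linear_sum.
apply: eq_bigr => i _.
rewrite !linearZ_LR free_mapE; congr (_ *: _).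
by rewrite [RHS]fm_liftE.
Qed.

End FiniteGeneration.

Section FiniteStage.
Variables (k : comPzRingType) (D : category) (mu : D -> set D).
Hypotheses (hmu : homological_modulus k mu) (noeth : noetherian k).
Variables (V : rep k D) (B A : set D).
Hypothesis gV : fin_gen V B.
Hypothesis finA : forall x y, A x -> A y -> finite_set [set: @Mor D x y].

(** As in [modulus_stage], with free covers on finitely many generators.  The
    sets [mu (deg t)] are finite, and in each of these degrees the free cover has
    a finite basis, so that its submodule of relations is finitely generated. *)
Lemma fin_gen_stage n :
  (forall p, (p <= n)%N -> modulus_iter mu p B `<=` A) ->
  (forall p x, (p < n)%N -> modulus_iter mu p B x -> finite_set (mu x)) ->
  exists S : stage k D, [/\ projective (st_amb S),
    st_equiv (ext_stage V n) S & fin_gen (st_ker S) (modulus_iter mu n B)].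
Proof.
elim: n => [|n IH] MA fmu.
  exists (ext_stage V 0); split=> //; [exact: free_on_proj|exact: st_equiv_refl].
have [||S [PS eS [T [deg [v [fT Bd vs]]]]]] := IH.
- by move=> p pn; apply: MA; exact: leqW.
- by move=> p x pn; apply: fmu; exact: leqW.
have PF : projective (free_on k deg) by exact: free_on_proj.
have sT := ker_step PF vs.
exists (Stage (ker_incl (free_map v))); split=> //=.
  exact: (step_equiv (@ext_stage_proj k D V n) PS (@ext_step k D V n) sT eS).
pose Z := {t : T & {y | mu (deg t) y}}.
pose e (z : Z) := sval (tagged z).
have Mz z : modulus_iter mu n.+1 B (e z).
  by exists (deg (tag z)); [exact: Bd|exact: svalP (tagged z)].
apply: (fin_gen_pointwise (e := e)) => // [||z].
- apply: finite_type_sigma => // t; apply: finite_set_type.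
  exact: fmu (Bd t).
- apply: generated_reindex (ker_generated hmu (f := free_map v)).
  move=> [y By]; have [_ [t _ <-] my] := By.
  by exists (existT (fun t => {y | mu (deg t) y}) t (exist _ y my)).
have fgP : fg_mod (free_on k deg (e z)).
  apply: freemod_fg; apply: finite_type_sigma => // t; apply: finite_setT_type.
  by apply: finA; [exact: MA (Bd t)|exact: MA (Mz z)].
pose f (_ : unit) := ker_incl (free_map v) (e z).
apply: (noetherian_embed (f := f) (L := [:: tt]) noeth) => [_ _ //|u].
by move=> /(_ tt (or_introl erefl)) u0; exact: val_inj.
Qed.

(** Evaluation at finitely many generators of the [q]-th syzygy [st_ker S]
    embeds [Hom(st_ker S, W)] in finitely many values of [W]. *)
Lemma Ext_fg (W : rep k D) q :
  (forall p, (p <= q)%N -> modulus_iter mu p B `<=` A) ->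
  (forall p x, (p < q)%N -> modulus_iter mu p B x -> finite_set (mu x)) ->
  (forall x, A x -> fg_mod (W x)) -> fg_mod (Ext q V W).
Proof.
move=> MA fmu fW.
have [S [_ eS [T [deg [v [[s sT] Bd vs]]]]]] := fin_gen_stage MA fmu.
have [a [a' [b [b' [aE bE ba ab]]]]] := eS.
have eS' : st_equiv S (ext_stage V q) by exists b, b', a, a'.
apply: fg_quot (equiv_quot eS' (Ext_quot V q W)) _.
have lin t : linear (fun g : nat_trans (st_ker S) W => g (deg t) (v t)) by [].
pose h t := GRing.isLinear.Build k (nat_trans (st_ker S) W) (W (deg t)) _
  (fun g : nat_trans (st_ker S) W => g (deg t) (v t)) (lin t).
pose ev t : {linear nat_trans (st_ker S) W -> W (deg t)} :=
  HB.pack (fun g : nat_trans (st_ker S) W => g (deg t) (v t)) (h t).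
apply: (noetherian_embed (f := ev) (L := s) noeth) => // [t _|g g0].
  exact: fW (MA _ _ _ (Bd t)).
apply: nat_trans_ext => x w; have [u <-] := vs x w.
have gv : nt_comp g (free_map v) = 0.
  apply: free_nt_eq => t; rewrite nt_compE free_mapE rep_map1.
  exact: g0.
exact: (congr1 (fun f : nat_trans (free_on k deg) W => f x u) gv).
Qed.

End FiniteStage.

Theorem corollary1p12 (k : comPzRingType) (D : category) (mu : D -> set D)
    (hmu : homological_modulus k mu)
    (V : rep k D) (I : Type) (d : I -> D) (hV : generated_in V d)
    (q : nat) (W : rep k D) :
  let objs : set D :=
    \bigcup_(p in [set p | (p <= q.+1)%N]) modulus_iter mu p (range d) in
  let E := full_subcat objs in
  let V' : rep k E := restrict_rep objs V in
  let W' : rep k E := restrict_rep objs W in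
  lmod_iso (Ext q V W) (Ext q V' W') /\
  (noetherian k ->
   fg_rep V ->
   (forall x : E, fg_mod (W' x)) ->
   (forall x y : E, finite_set [set: Mor x y]) ->
   (forall (p : nat) (x : D),
      (p < q)%N -> modulus_iter mu p (range d) x -> finite_set (mu x)) ->
   fg_mod (Ext q V W)).
Proof.
move=> objs E V' W'.
have MA p : (p <= q.+1)%N -> modulus_iter mu p (range d) `<=` objs.
  by move=> pq x Mx; exists p.
split; first exact: Ext_restrict hmu (generated_range hV) MA.
move=> noeth fV fW fE fmu.
apply: (Ext_fg hmu noeth (fin_gen_range fV hV) (A := objs)) => //.
- by move=> x y Ax Ay; exact: (fE (exist _ x Ax) (exist _ y Ay)).
- by move=> p pq; apply: MA; exact: leqW.
by move=> x Ax; exact: (fW (exist _ x Ax)).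
Qed.
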